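(* Let $G$ be a second countable locally compact Abelian group, let $(\Gamma_j)_{j\in J}$ be a (countable) family of closed, co-compact subgroups $\Gamma_j\subseteq G$ and let $E\in\mathcal E$. Suppose that for any compact set $K\subseteq\widehat G\setminus E$ there exist a compact set $Q$ with $K\subseteq Q\subseteq\widehat G\setminus E$ and a constant $C=C(K)>0$ such that $$\operatorname*{ess\,inf}_{\omega\in Q}\sum_{\alpha\in\Gamma_j^\perp}\mathbf 1_Q(\omega\alpha)\ge C\,\mathrm{d}(\Gamma_j)\qquad\text{for all } j\in J.$$ Moreover, suppose that the generalised translation-invariant system $\bigcup_{j\in J}\{T_\gamma g_{j,p}\}_{\gamma\in\Gamma_j,\,p\in P_j}$ satisfies the local integrability condition with respect to $E$. Then the generating functions $\bigcup_{j\in J}\{g_{j,p}\}_{p\in P_j}$ are strictly temperate with respect to $E$.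
   Context: $G$ is a second countable locally compact Hausdorff Abelian group, written additively, with Haar measure $\mu_G$; $\widehat G$ is its Pontryagin dual, written multiplicatively, with the Plancherel Haar measure $\mu_{\widehat G}$ relative to $\mu_G$. $\hat f$ is the Fourier–Plancherel transform of $f\in L^2(G)$, and $T_\gamma f = f(\cdot-\gamma)$. For a closed subgroup $\Gamma\subseteq G$, $\Gamma^\perp=\{\omega\in\widehat G: \omega(x)=1\ \forall x\in\Gamma\}$. $\Gamma$ is co-compact if $G/\Gamma$ is compact. Each $\Gamma$ carries a given Haar measure $\mu_\Gamma$ (the counting measure if $\Gamma$ is a uniform lattice, i.e. discrete and co-compact), $G/\Gamma$ carries the Haar measure making Weil's formula $\int_G f\,d\mu_G=\int_{G/\Gamma}\int_\Gamma f(x+\gamma)\,d\mu_\Gamma(\gamma)\,d\mu_{G/\Gamma}(\dot x)$ hold, and the covolume is $\mathrm{d}(\Gamma)=\mu_{G/\Gamma}(G/\Gamma)$. Generalised translation-invariant (GTI) system: $J$ is countable; for each $j\in J$, $\Gamma_j\subseteq G$ is a closed, co-compact subgroup and $P_j$ is an index set with functions $g_{j,p}\in L^2(G)$, $p\in P_j$; the system is $\bigcup_{j\in J}\{T_\gamma g_{j,p}:\gamma\in\Gamma_j,p\in P_j\}$. Standing hypotheses for each $j$: (I) $(P_j,\Sigma_{P_j},\mu_{P_j})$ is a $\sigma$-finite measure space; (II) $p\mapsto g_{j,p}$ is measurable from $(P_j,\Sigma_{P_j})$ to $L^2(G)$ with its Borel $\sigma$-algebra; (III) $(p,x)\mapsto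 g_{j,p}(x)$ is $\Sigma_{P_j}\otimes\mathcal B_G$-measurable. $\mathcal E$ is the collection of closed sets $E\subseteq\widehat G$ of Haar measure zero. $\mathcal D_E(G)$ is the set of $f\in L^2(G)$ such that $\hat f\in L^\infty(\widehat G)$ has compact support $\operatorname{supp}\hat f\subseteq\widehat G\setminus E$. Local integrability condition (w.r.t. $E$): for all $f\in\mathcal D_E(G)$, $$\sum_{j\in J}\frac1{\mathrm{d}(\Gamma_j)}\int_{P_j}\sum_{\alpha\in\Gamma_j^\perp}\int_{\operatorname{supp}\hat f}|\hat f(\omega\alpha)\hat g_{j,p}(\omega)|^2\,d\mu_{\widehat G}(\omega)\,d\mu_{P_j}(p)<\infty.$$ Equivalently, for all compact $K\subseteq\widehat G\setminus E$, $\sum_{j\in J}\frac1{\mathrm{d}(\Gamma_j)}\int_{P_j}\sum_{\alpha\in\Gamma_j^\perp}\int_{K\cap\alpha^{-1}K}|\hat g_{j,p}(\omega)|^2\,d\mu_{\widehat G}(\omega)\,d\mu_{P_j}(p)<\infty$. Strictly temperate (w.r.t. $E$): $\sum_{j\in J}\int_{P_j}|\hat g_{j,p}(\cdot)|^2\,d\mu_{P_j}(p)\in L^1_{\mathrm{loc}}(\widehat G\setminus E)$, i.e. it is integrable over every compact $K\subseteq\widehat G\setminus E$. *)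

(* Defs.v *)
From HB Require Import structures.
From mathcomp Require Import all_boot all_order all_algebra.
From mathcomp Require Import all_classical all_reals all_analysis.
From mathcomp Require Import measurable_realfun ess_sup_inf.
From mathcomp Require Import complex.

Set Implicit Arguments.
Unset Strict Implicit.
Unset Printing Implicit Defensive.

Import Order.TTheory GRing.Theory Num.Theory.
Import numFieldNormedType.Exports.
Import ComplexField.Normc.

Local Open Scope classical_set_scope.
Local Open Scope ring_scope.
Local Open Scope complex_scope.

(* An abelian group with a topology, equipped with its Borel sigma-algebra.
   A measurableType must be pointed; the chosen point is 0. *)
Definition borel (T : PreTopologicalZmodule.type) : Type := T.

HB.instance Definition _ (T : PreTopologicalZmodule.type) :=
  Choice.on (borel T).
HB.instance Definition _ (T : PreTopologicalZmodule.type) :=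
  isPointed.Build (borel T) (0 : T).
HB.instance Definition _ (T : PreTopologicalZmodule.type) :=
  Measurable.copy (borel T)
    (g_sigma_algebraType (@open T : set (set (borel T)))).

(* Nonzero translation-invariant Radon measure. *)
Definition haar_measure (R : realType) (T : PreTopologicalZmodule.type)
    (mu : {measure set (borel T) -> \bar R}) : Prop :=
  [/\ mu setT != 0%E,
      forall (a : T) (A : set (borel T)), measurable A ->
        mu [set (a + x : T) | x in (A : set T)] = mu A,
      forall K : set T, compact K -> (mu K < +oo)%E,
      forall A : set (borel T), measurable A ->
        mu A = ereal_inf [set mu U | U in [set U : set T | open U /\ A `<=` U]]
    & forall U : set T, open U ->
        mu U = ereal_sup [set mu K | K in [set K : set T | compact K /\ K `<=` U]]].

(* A subgroup with the subspace topology. *)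
Definition subgroup (G : topologicalZmodType) (H : zmodClosed G) : Type :=
  {x : G | x \in H}.

HB.instance Definition _ (G : topologicalZmodType) (H : zmodClosed G) :=
  SubChoice.on (subgroup H).
HB.instance Definition _ (G : topologicalZmodType) (H : zmodClosed G) :=
  [SubChoice_isSubZmodule of subgroup H by <:].
HB.instance Definition _ (G : topologicalZmodType) (H : zmodClosed G) :=
  Topological.copy (subgroup H)
    (initial_topology (val : subgroup H -> G)).

(* The quotient group G / H with the quotient topology. *)
Definition qgroup (G : topologicalZmodType) (H : zmodClosed G) : Type :=
  quotient_topology (Quotient.quot H).

HB.instance Definition _ (G : topologicalZmodType) (H : zmodClosed G) :=
  Topological.on (qgroup H).
HB.instance Definition _ (G : topologicalZmodType) (H : zmodClosed G) :=
  GRing.isZmodule.Build (qgroup H) (@Quotient.addqA G H) (@Quotient.addqC G H)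
    (@Quotient.add0q G H) (@Quotient.addNq G H).

(* Weil's formula; the inner integral depends only on the coset q, so it may be
   computed at the representative repr q. *)
Definition weil_formula (R : realType) (G : topologicalZmodType)
    (H : zmodClosed G)
    (muG : {measure set (borel G) -> \bar R})
    (muH : {measure set (borel (subgroup H)) -> \bar R})
    (muQ : {measure set (borel (qgroup H)) -> \bar R}) : Prop :=
  forall f : G -> \bar R,
    measurable_fun setT (f : borel G -> \bar R) ->
    (forall x, (0 <= f x)%E) ->
    (\int[muG]_x f x =
     \int[muQ]_q \int[muH]_h
        f (repr (q : Quotient.quot H) + val (h : subgroup H))%R)%E.

Definition covolume (R : realType) (G : topologicalZmodType)
    (H : zmodClosed G) (muQ : {measure set (borel (qgroup H)) -> \bar R}) :
    \bar R :=
  muQ setT.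

(* The Pontryagin dual, with the compact-open topology.  As the group structure
   is a zmodType, the product of the characters w and a is written w + a. *)
Definition is_character (R : realType) (G : topologicalZmodType)
    (w : G -> R[i]^o) : Prop :=
  [/\ continuous w, forall x, `|w x| = 1
    & forall x y, w (x + y) = w x * w y].

Definition pdual (R : realType) (G : topologicalZmodType) : Type :=
  [set w : {compact-open, G -> R[i]^o} | is_character w].

Section DualGroup.
Variables (R : realType) (G : topologicalZmodType).

HB.instance Definition _ := Topological.on (pdual R G).

Definition char_fun (w : pdual R G) : G -> R[i] := set_val w.

Lemma char_funP (w : pdual R G) : is_character (char_fun w).
Proof. exact: set_valP. Qed.

Definition mk_char (w : G -> R[i]) (hw : is_character w) : pdual R G :=
  exist _ (w : {compact-open, G -> R[i]^o}) (mem_set hw).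

Lemma char_fun_inj : injective char_fun.
Proof. exact: val_inj. Qed.

Lemma char_one_subproof : is_character (fun _ : G => 1 : R[i]^o).
Proof.
by split=> [x|x|x y]; [exact: cvg_cst|rewrite normr1|rewrite mulr1].
Qed.

Lemma char_mul_subproof (w a : pdual R G) :
  is_character (fun x => char_fun w x * char_fun a x : R[i]^o).
Proof.
have [wc w1 wD] := char_funP w; have [ac a1 aD] := char_funP a.
split=> [x|x|x y]; first exact: (cvgM (wc x) (ac x)).
  by rewrite normrM w1 a1 mulr1.
by rewrite wD aD mulrACA.
Qed.

Lemma char_inv_subproof (w : pdual R G) :
  is_character (fun x => (char_fun w x)^-1 : R[i]^o).
Proof.
have [wc w1 wD] := char_funP w.
have w0 x : char_fun w x != 0 by rewrite -normr_gt0 w1 ltr01.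
split=> [x|x|x y]; first exact: (cvgV (w0 x) (wc x)).
  by rewrite normfV w1 invr1.
by rewrite wD invfM.
Qed.

Definition char_one := mk_char char_one_subproof.
Definition char_mul w a := mk_char (char_mul_subproof w a).
Definition char_inv w := mk_char (char_inv_subproof w).

Lemma char_mulA : associative char_mul.
Proof. by move=> u v w; apply/char_fun_inj/funext => x; exact: mulrA. Qed.

Lemma char_mulC : commutative char_mul.
Proof. by move=> u v; apply/char_fun_inj/funext => x; exact: mulrC. Qed.

Lemma char_mul1 : left_id char_one char_mul.
Proof. by move=> u; apply/char_fun_inj/funext => x; exact: mul1r. Qed.

Lemma char_mulV : left_inverse char_one char_inv char_mul.
Proof.
move=> u; apply/char_fun_inj/funext => x; apply: mulVf.
by have [_ u1 _] := char_funP u; rewrite -normr_gt0 u1 ltr01.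
Qed.

HB.instance Definition _ :=
  GRing.isZmodule.Build (pdual R G) char_mulA char_mulC char_mul1 char_mulV.

End DualGroup.

Coercion char_fun : pdual >-> Funclass.

Definition annihilator (R : realType) (G : topologicalZmodType)
    (H : zmodClosed G) : set (pdual R G) :=
  [set w | forall x, x \in H -> w x = 1].
Arguments annihilator R {G} H.

Section ComplexFunctions.
Context d (T : measurableType d) (R : realType).
Implicit Types (mu : {measure set T -> \bar R}) (f : T -> R[i]).

Definition cmeasurable f : Prop :=
  measurable_fun setT (fun x => complex.Re (f x)) /\
  measurable_fun setT (fun x => complex.Im (f x)).

Definition cintegral mu f : R[i] :=
  (\int[mu]_x complex.Re (f x)) +i* (\int[mu]_x complex.Im (f x)).

Definition cLfun (p : nat) mu : set (T -> R[i]) :=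
  [set f | cmeasurable f /\
           (\int[mu]_x ((normc (f x) ^+ p)%:E) < +oo)%E].

Definition sqnorm2 mu f : \bar R := \int[mu]_x ((normc (f x) ^+ 2)%:E).

(* The open sets of L^2(mu), as sets of representatives: a set open for the
   L^2-seminorm is saturated for equality almost everywhere. *)
Definition L2_open mu : set (set (T -> R[i])) :=
  [set U | U `<=` cLfun 2 mu /\
    forall f, U f -> exists2 e : R, 0 < e &
      forall h, cLfun 2 mu h ->
        (sqnorm2 mu (fun x => f x - h x)%R < (e ^+ 2)%:E)%E -> U h].

Definition ess_inf_on mu (Q : set T) (f : T -> \bar R) : \bar R :=
  ess_inf mu (fun x => if x \in Q then f x else +oo%E).

End ComplexFunctions.

Definition fourier (R : realType) (G : topologicalZmodType)
    (mu : {measure set (borel G) -> \bar R}) (f : G -> R[i]) (w : pdual R G) :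
    R[i] :=
  cintegral mu (fun x => f x * (w x)^*).

(* F computes a representative of the Fourier-Plancherel transform of each
   f in L^2(mu), and nu is the Plancherel measure relative to mu: F is the
   unitary map L^2(mu) -> L^2(nu) extending the Fourier integral from the dense
   subspace L^1 & L^2 (intersection); these clauses determine F f up to null sets.
   Values of F outside L^2(mu) are irrelevant. *)
Definition plancherel_transform (R : realType) (G : topologicalZmodType)
    (mu : {measure set (borel G) -> \bar R})
    (nu : {measure set (borel (pdual R G)) -> \bar R})
    (F : (G -> R[i]) -> pdual R G -> R[i]) : Prop :=
  [/\ forall f, cLfun 2 mu f -> cLfun 2 nu (F f) /\ sqnorm2 nu (F f) = sqnorm2 mu f,
      forall (c : R[i]) f h, cLfun 2 mu f -> cLfun 2 mu h ->
        {ae nu, forall w, F (fun x => c * f x + h x) w = c * F f w + F h w},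
      forall f, cLfun 1 mu f -> cLfun 2 mu f ->
        {ae nu, forall w, F f w = fourier mu f w}
    & forall phi, cLfun 2 nu phi ->
        exists2 f, cLfun 2 mu f & {ae nu, forall w, F f w = phi w}].

(* The support of an almost everywhere defined function: the complement of the
   largest open set on which it vanishes almost everywhere. *)
Definition ess_support (R : realType) (T : PreTopologicalZmodule.type)
    (nu : {measure set (borel T) -> \bar R}) (phi : T -> R[i]) : set T :=
  ~` \bigcup_(U in [set U : set T | open U /\
                       {ae nu, forall w, U w -> phi w = 0}]) U.

Section GTI.
Variables (R : realType) (G : topologicalZmodType).
Variable muG : {measure set (borel G) -> \bar R}.
Variable nu : {measure set (borel (pdual R G)) -> \bar R}.
Variable FP : (G -> R[i]) -> pdual R G -> R[i].
Variable E : set (pdual R G).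

Definition D_E : set (G -> R[i]) :=
  [set f | [/\ cLfun 2 muG f,
               (ess_sup nu (fun w => (normc (FP f w))%:E) < +oo)%E,
               compact (ess_support nu (FP f))
             & ess_support nu (FP f) `<=` ~` E]].

Variables (J : countType) (Gamma : J -> zmodClosed G).
Variable muQ : forall j, {measure set (borel (qgroup (Gamma j))) -> \bar R}.
Variables (d : J -> measure_display) (P : forall j, measurableType (d j)).
Variable muP : forall j, {measure set (P j) -> \bar R}.
Variable g : forall j, P j -> G -> R[i].

Definition local_integrability : Prop :=
  forall f, D_E f ->
    (\esum_(j in [set: J]) ((fine (covolume (muQ j)))^-1%:E *
       \int[muP j]_p \esum_(a in annihilator R (Gamma j))
         \int[nu]_(w in ess_support nu (FP f))
           ((normc (FP f (w + a : pdual R G)%R * FP (g p) w) ^+ 2)%:E))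
     < +oo)%E.

(* For each p, FP (g p) is only a representative; the inner integral over P j
   of a value at w requires a jointly measurable choice of representatives.
   Such choices exist, and two of them give, by Fubini, the same function of w
   almost everywhere. *)
Definition measurable_version (h : forall j, P j -> pdual R G -> R[i]) : Prop :=
  forall j,
    cmeasurable (fun z : (P j * borel (pdual R G))%type => h j z.1 z.2) /\
    forall p, {ae nu, forall w, h j p w = FP (g p) w}.

Definition strictly_temperate : Prop :=
  (exists h, measurable_version h) /\
  forall h, measurable_version h ->
    forall K : set (pdual R G), compact K -> K `<=` ~` E ->
      nu.-integrable K (fun w =>
        \esum_(j in [set: J]) \int[muP j]_p ((normc (h j p w) ^+ 2)%:E))%E.

End GTI.

(* Main.v *)
Require Import Defs.
From HB Require Import structures.
From mathcomp Require Import all_boot all_order all_algebra.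
From mathcomp Require Import all_classical all_reals all_analysis.
From mathcomp Require Import measurable_realfun ess_sup_inf.
From mathcomp Require Import complex.
From mathcomp Require Import ring lra.

(* Let Q and C be given for K and let f have Plancherel transform 1_Q; then f is
   in D_E, so the local integrability condition applies to f.  Its j-th term is
   1/d(Gamma_j) times the integral over P_j of
     int_Q (sum_(a in Gamma_j^perp) 1_Q(w a)) |g_jp^(w)|^2 dw
       >= C d(Gamma_j) int_Q |g_jp^(w)|^2 dw,
   and Tonelli on Q, which has finite measure, gives the integrability.
   - The sum over a may be exchanged with the integral because only finitely
     many a in Gamma_j^perp satisfy Q a meets Q: Gamma_j being co-compact, a
     character trivial on Gamma_j and close to 1 on a suitable compact set is 1.
   - The essential support of 1_Q may be smaller than Q, but only by a null set,
     by regularity of the Haar measure.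
   - A jointly measurable choice of the transforms g_jp^ exists for indicators of
     rectangles, and such choices survive linear combinations and L^2-limits
     (along a subsequence chosen measurably in p), which reaches every jointly
     measurable family in L^2. *)

Set Implicit Arguments.
Unset Strict Implicit.
Unset Printing Implicit Defensive.

Import Order.TTheory GRing.Theory Num.Theory.
Import numFieldNormedType.Exports.

Local Open Scope classical_set_scope.
Local Open Scope ring_scope.
Local Open Scope complex_scope.

Import ComplexField.Normc.

(** * The dual group and annihilators *)

Section Normc.
Variable R : realType.
Implicit Types z : R[i].

Lemma normc_le_add z1 z2 : normc (z1 + z2) <= normc z1 + normc z2.
Proof. exact: (@le_normcD R z1 z2). Qed.

Lemma normc_opp z : normc (- z) = normc z.
Proof. exact: (@normcN R z). Qed.

Lemma normc_distC z1 z2 : normc (z1 - z2) = normc (z2 - z1).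
Proof. by rewrite -normc_opp opprB. Qed.

Lemma normc_ge0 z : 0 <= normc z.
Proof. by case: z => a b; exact: sqrtr_ge0. Qed.

Lemma normc_dist_add z1 z2 z3 :
  normc (z1 - z3) <= normc (z1 - z2) + normc (z2 - z3).
Proof. by rewrite -(subrKA z2) normc_le_add. Qed.

(* If |z - 1| < 1/2 then |z + 1| > 3/2, so |z^2 - 1| > (3/2) |z - 1|: iterating,
   the powers of z leave the disc unless z = 1. *)
Lemma eq1_powers_near1 z : (forall n, normc (z ^+ n - 1) < 2^-1) -> z = 1.
Proof.
move=> zn; apply/eqP; rewrite -subr_eq0; apply/eqP/eq0_normc/eqP.
rewrite eq_le normc_ge0 andbT leNgt; apply/negP => z1.
have grow n : (3 / 2) ^+ n * normc (z - 1) <= normc (z ^+ (2 ^ n) - 1).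
  elim: n => [|n IH]; first by rewrite expr0 mul1r expn0 expr1.
  rewrite expnS mulnC exprM subr_sqr_1 normcM exprSr -mulrA mulrCA.
  have := zn (2 ^ n)%N; set y := z ^+ (2 ^ n) in IH * => yn.
  rewrite (le_trans (ler_wpM2l _ IH))//.
  rewrite mulrC ler_wpM2l ?normc_ge0//.
  have := normc_dist_add 2 (1 - y) 0; rewrite !subr0.
  have -> : 2 - (1 - y) = y + 1 by rewrite -addrA; ring.
  rewrite (_ : normc 2 = 2) ?(normc_distC 1); first lra.
  by have := @normcMn R (1 : R[i]) 2; rewrite normc1.
(* A linear lower bound is enough: [n] is then chosen with n |z - 1| > 1, which forces |z^(2^n) - 1|
   > 1/2. *)
have bern n : n%:R / 2 <= (3 / 2) ^+ n :> R.
  elim: n => [|n IH]; first by rewrite mul0r expr0.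
  have X1 : 1 <= (3 / 2) ^+ n :> R by rewrite exprn_ege1//; lra.
  rewrite exprS -natr1; move: (n%:R) IH => m; move: (_ ^+ _) X1 => X; lra.
pose n := (Num.truncn (normc (z - 1))^-1).+1.
have : 1 < n%:R * normc (z - 1).
  by rewrite -ltr_pdivrMr// mul1r truncnS_gt.
have := grow n; have := zn (2 ^ n)%N.
have := ler_wpM2r (normc_ge0 (z - 1)) (bern n).
by lra.
Qed.

End Normc.

(** Compactness enters as a near-covering property along the filter of finite subsets of [A] ordered
    by inclusion: some finite subset has neighbourhoods [N x] that already cover [A]. The sets [N x]
    need not be open. *)
Lemma compact_nbhs_cover (T : topologicalType) (A : set T) (N : T -> set T) :
  compact A -> (forall x, A x -> nbhs x (N x)) ->
  exists D : set T, [/\ finite_set D, D `<=` A & A `<=` \bigcup_(x in D) N x].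
Proof.
move=> /compact_near_coveringP cA nN.
pose fin_sub := [set S : set T | finite_set S /\ S `<=` A].
pose F := filter_from fin_sub (fun S => [set S' | fin_sub S' /\ S `<=` S']).
have FF : Filter F.
  apply: filter_from_filter; first by exists set0; split.
  move=> S S' [fS SA] [fS' S'A]; exists (S `|` S').
    by split; [rewrite finite_setU|rewrite subUset].
  by move=> S'' [fS'' SS'']; split; split=> // x Sx; apply: SS''; [left|right].
have [|S [fS SA] AS] := cA _ F (fun S x => (\bigcup_(y in S) N y) x) FF.
  move=> x Ax; exists (N x, [set S | fin_sub S /\ [set x] `<=` S]).
    split; first exact: nN.
    by exists [set x] => //; split=> // _ ->.
  by move=> [y S] /= [Ny [_ xS]]; exists x => //; exact: xS.
by exists S; split=> //; exact: (AS S (conj (conj fS SA) (@subset_refl _ S))).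
Qed.

(** * The topology of the dual group *)

Section DualTopology.
Variables (R : realType) (G : topologicalZmodType).
Implicit Types (w a : pdual R G) (L : set G).

Definition uball w L (e : R) : set (pdual R G) :=
  fun v => forall x, L x -> normc (w x - v x) < e.

(** At a continuous limit the compact-open topology is that of uniform convergence on compact sets,
    so the sets [uball w L e] with [L] compact serve as basic neighbourhoods of [w]. *)
Lemma pdual_cvgP (F : set_system (pdual R G)) w : Filter F ->
  F --> w <-> forall L (e : R), compact L -> 0 < e ->
    F (uball w L e).
Proof.
move=> FF; have [wc _ _] := char_funP w.
have step : F --> w <-> {compact-open, (char_fun (G:=G) (R:=R) @ F) --> (char_fun w : G -> R[i]^o)}.
  split=> [Fw A nA|Fw A].
    apply: Fw; move: nA => /(@initial_continuous _ _ (set_val : pdual R G -> {compact-open, G -> R[i]^o}) w).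
    by [].
  case=> B [[C oC <-] Cw CA].
  apply: (filterS CA); apply: Fw.
  by apply: open_nbhs_nbhs; split.
rewrite step (@compact_open_fam_compactP _ _ _ _ wc _) fam_cvgP.
split=> [Fw L e cL e0|Fw L cL].
  have /= := Fw L cL [set v | forall x, L x -> normc (w x - v x) < e].
  apply.
  apply/uniform_nbhs; exists [set z : R[i]^o * R[i]^o | `|z.1 - z.2| < e%:C]; split=> //=.
    rewrite -entourage_ballE; exists e%:C => //=.
    by rewrite ltcR.
  by move=> v wv y Ly; rewrite -ltcR; exact: wv.
move=> A /uniform_nbhs [E0 [entE EA]].
move: entE; rewrite -entourage_ballE => -[e e0 eE].
(* Balls in [R[i]] have radii in [R[i]]; being positive for its partial order forces imaginary part
   0. *)
have er : e = (complex.Re e)%:C.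
  by move: e0; case: (e) => u v; rewrite /= ltcE/= => /andP[/eqP -> _].
have re0 : 0 < complex.Re e by rewrite -ltcR -er.
have Fu := Fw L _ cL re0.
change (F ((@char_fun R G) @^-1` A)).
apply: (filterS _ Fu) => v Lv.
apply: EA => y Ly; apply: eE => /=.
by rewrite /ball/= er ltcR; exact: Lv.
Qed.

(** Singletons are compact, so a neighbourhood can control the value at one point; inseparable
    characters are then arbitrarily close there. *)
Lemma pdual_hausdorff : hausdorff_space (pdual R G).
Proof.
move=> p q pq; apply/char_fun_inj/funext => x.
apply/eqP; rewrite -subr_eq0; apply/eqP/eq0_normc/eqP.
rewrite eq_le normc_ge0 andbT; apply/ler_addgt0Pr => e e0; rewrite add0r.
have nb w : nbhs w (uball w [set x] (e / 2)).
  by have /pdual_cvgP := @cvg_id _ (nbhs w); apply; [exact: compact_set1|rewrite divr_gt0].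
have [v0 [pv' qv']] := pq _ _ (nb p) (nb q).
set v : pdual R G := v0 in pv' qv'.
have pv : normc (char_fun p x - char_fun v x) < e / 2 := pv' x erefl.
have qv : normc (char_fun q x - char_fun v x) < e / 2 := qv' x erefl.
rewrite (le_trans (normc_dist_add _ (char_fun v x) _))// [leRHS]splitr.
by rewrite lerD// ltW// normc_distC.
Qed.

Lemma normc_char w x : normc (w x) = 1.
Proof.
by have [_ /(_ x) w1 _] := char_funP w; move: w1 => /(congr1 (@complex.Re R)).
Qed.

Lemma char0 w : w 0 = 1.
Proof.
have [_ _ /(_ 0 0)] := char_funP w; rewrite addr0.
have : w 0 != 0.
  by apply/eqP => w0; have := normc_char w 0; rewrite w0 normc0 => /eqP; rewrite eq_sym oner_eq0.
by move=> w0 /eqP; rewrite eq_sym -{3}[w 0]mulr1 (inj_eq (mulfI w0)) => /eqP.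
Qed.

Lemma charD w x y : w (x + y) = w x * w y.
Proof. by have [_ _] := char_funP w. Qed.

Lemma char_addE w a x : (w + a : pdual R G) x = w x * a x.
Proof. by []. Qed.

Lemma char_subE w a x : (w - a : pdual R G) x = w x / a x.
Proof. by []. Qed.

Lemma char_mulrn w x n : w (x *+ n) = w x ^+ n.
Proof. by elim: n => [|n IH]; rewrite ?char0// mulrS charD IH exprS. Qed.

(** As |a x| = 1, translation by [a] preserves |w x - v x| at every point. *)
Lemma pdual_addr_continuous a : continuous (fun w => w + a).
Proof.
move=> w.
have FF : Filter ((fun w' : pdual R G => w' + a) @ nbhs w) by exact: fmap_filter.
apply/(@pdual_cvgP _ _ FF) => L e cL e0.
have /pdual_cvgP/(_ L e cL e0) := @cvg_id _ (nbhs w).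
move=> Fu; change (nbhs w ((fun w' : pdual R G => w' + a) @^-1` uball (w + a) L e)).
apply: (@filterS _ _ (nbhs_filter w) _ _ _ Fu) => v wv x Lx.
by rewrite /= -mulrBl normcM normc_char mulr1; exact: wv.
Qed.

End DualTopology.

(** * Annihilators of co-compact subgroups *)

Section Annihilator.
Variables (R : realType) (G : topologicalZmodType).
Hypothesis lcG : locally_compact [set: G].
Variable H : zmodClosed G.
Hypothesis cH : compact [set: qgroup H].
Implicit Types (w a : pdual R G) (L : set G).

Let qpi (x : G) : qgroup H := (\pi_(Quotient.quot H) x)%qT.

Let qpiP x y : qpi x = qpi y <-> x - y \in H.
Proof. by rewrite (Quotient.idealrBE H x y); split=> [xy|/eqP//]; apply/eqP. Qed.

(** The saturation of [U] is the union of its translates by elements of [H], all of them open. *)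
Lemma qgroup_pi_open (U : set G) : open U ->
  open (qpi @` U).
Proof.
move=> oU.
rewrite /open/= /quotient_open.
have -> : (\pi_(qgroup H))%qT @^-1` (qpi @` U) =
   \bigcup_(h in [set h : G | h \in H]) ((fun x => x + h) @^-1` U).
  apply/seteqP; split=> [x [y Uy yx]|x [h hH Uxh]].
    exists (y - x); last by rewrite /= addrC subrK.
    exact/qpiP.
  by exists (x + h) => //; apply/qpiP; rewrite addrAC subrr add0r.
apply: bigcup_open => h _; apply: open_comp => // x _.
by apply: (@continuous2_cvg _ _ _ _ _ _ _ _ +%R x h (@add_continuous G (x, h)));
  [exact: cvg_id|exact: cvg_cst].
Qed.

(** The interiors of compact neighbourhoods of coset representatives have open images in the compact
    quotient. Finitely many of these images cover it, and [L] is the union of the corresponding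
    compact neighbourhoods. *)
Lemma cocompact_exhaustion : exists2 L, compact L &
  forall x, exists2 y, L y & x - y \in H.
Proof.
have exK (x : G) : exists k : set G, nbhs x k /\ compact k.
  have [U] := lcG (I : [set: G] x).
  by rewrite withinET => nU [cU _]; exists U.
have [K Kn] := choice exK.
have nf (q : qgroup H) : nbhs q (qpi @` (K (repr (q : Quotient.quot H)))^°).
  apply: open_nbhs_nbhs; split; first exact/qgroup_pi_open/open_interior.
  exists (repr (q : Quotient.quot H)); last exact: reprK.
  exact: (Kn _).1.
have [D [fD _ DT]] := compact_nbhs_cover cH (fun q _ => nf q).
exists (\bigcup_(q in (D : set (qgroup H))) K (repr (q : Quotient.quot H))).
  move/finite_fsetP: fD => [X ->]; rewrite bigcup_fset.
  by apply: bigsetU_compact => i _; exact: (Kn _).2.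
move=> x; have [z Dz [y Kzy /qpiP xy]] := DT (qpi x) I.
exists y; first by exists z => //; exact: interior_subset.
by rewrite -opprB rpredN.
Qed.

Lemma annihilator_coset w x y : annihilator R H w -> x - y \in H -> w x = w y.
Proof. by move=> wH xy; rewrite -(subrK y x) charD wH// mul1r. Qed.

(** A character in the annihilator is constant on cosets, so the bound on [L] holds at every
    multiple of every [x]: all powers of [w x] stay within 1/2 of 1. *)
Lemma annihilator_eq0 L w : (forall x, exists2 y, L y & x - y \in H) ->
  annihilator R H w -> (forall x, L x -> normc (w x - 1) < 2^-1) -> w = 0.
Proof.
move=> LH wH wL; apply/char_fun_inj/funext => x /=.
apply: eq1_powers_near1 => n; rewrite -char_mulrn.
by have [y Ly xy] := LH (x *+ n); rewrite (annihilator_coset wH xy); exact: wL.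
Qed.

(* Two such [a] agree up to 1/2 on the compact set of representatives as soon as
   both [w] and [w + a] range over the same pair of small sets of a finite cover
   of [Q]. *)
Lemma finite_annihilator_shifts (Q : set (pdual R G)) : compact Q ->
  finite_set [set a | annihilator R H a /\ exists w, Q w /\ Q (w + a)].
Proof.
move=> cQ; have [L cL LH] := cocompact_exhaustion.
(* Four errors of size 1/8 enter the comparison of [a] and [a'] below, 1/2 in total. *)
pose N w := uball w L 8^-1.
have nN w : nbhs w (N w).
  by have /pdual_cvgP := @cvg_id _ (nbhs w); apply=> //; rewrite invr_gt0.
have [D [fD _ QD]] := compact_nbhs_cover cQ (fun w _ => nN w).
pose A (ik : pdual R G * pdual R G) := [set a | annihilator R H a /\
  exists w, N ik.1 w /\ N ik.2 (w + a)].
have A1 ik a a' : A ik a -> A ik a' -> a = a'.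
  move=> [aH [w [wi wk]]] [a'H [w' [w'i w'k]]].
  apply/eqP; rewrite -subr_eq0; apply/eqP.
  have a'0 x : a' x != 0.
    by apply/eqP => a'x; have := normc_char a' x; rewrite a'x normc0 => /eqP; rewrite eq_sym oner_eq0.
  apply: (annihilator_eq0 LH) => [x xH|x Lx]; rewrite char_subE.
    have ax : char_fun a x = 1 := aH x xH.
    have a'x : char_fun a' x = 1 := a'H x xH.
    by rewrite ax a'x invr1 mulr1.
  rewrite -[ltLHS]mulr1 -(normc_char a' x) -normcM mulrBl mul1r divfK; last exact: a'0.
  rewrite -[ltLHS]mul1r -(normc_char w x) -normcM mulrBr.
  have := normc_dist_add (w x * a x) (w' x * a' x) (w x * a' x).
  have := normc_dist_add (w x * a x) (ik.2 x) (w' x * a' x).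
  have := wk x Lx; have := w'k x Lx; rewrite !char_addE; have := wi x Lx; have := w'i x Lx.
  have := normc_dist_add (w' x) (ik.1 x) (w x).
  rewrite -[w' x * a' x - _]mulrBl normcM normc_char mulr1.
  rewrite /= (normc_distC (w x * a x) (ik.2 x)) (normc_distC (w' x) (ik.1 x)).
  by lra.
(* Each [A ik] has at most one element, so [xget] recovers every shift from one of the finitely many
   pairs of centres; the default 0 for an empty [A ik] only enlarges the image. *)
apply: (@sub_finite_set _ _ ((fun ik => xget (0 : pdual R G) (A ik)) @` (D `*` D))).
  move=> a [aH [w [Qw Qwa]]].
  have [i Di Nw] := QD w Qw.
  have [k Dk Nwa] := QD _ Qwa.
  exists (i, k) => //; have Aa : A (i, k) a by split=> //; exists w.
  by apply: (A1 (i, k)) => //; exact: xgetI Aa.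
by apply: finite_image; exact: finite_setX.
Qed.

End Annihilator.

(** * Measurable versions of a family of transforms *)

Section SigmaFinite.
Context d d' (X : measurableType d) (Y : measurableType d') (R : realType).
Variables (m : {measure set Y -> \bar R}) (sm : sigma_finite setT m).

(** The hypothesis [sm] occurs in the body so that the sigma-finite structure attached to [m'] can
    depend on it. *)
Let m' : set Y -> \bar R := let _ := sm in m.
HB.instance Definition _ := Measure.on m'.
HB.instance Definition _ := @Measure_isSigmaFinite.Build _ _ _ m' sm.

Lemma sigma_finite_fubini_F (f : X * Y -> \bar R) :
  measurable_fun setT f -> (forall z, (0 <= f z)%E) ->
  measurable_fun setT (fun x => \int[m]_y f (x, y))%E.
Proof.
by move=> mf f0; exact: (@measurable_fun_fubini_tonelli_F _ _ _ _ _ m' f).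
Qed.

End SigmaFinite.

(** * Squared moduli and complex-valued L^2 functions *)

Section SquaredNormc.
Variable R : realType.
Implicit Types z : R[i].

Lemma sqr_normcE z : normc z ^+ 2 = complex.Re z ^+ 2 + complex.Im z ^+ 2.
Proof. by case: z => a b /=; rewrite sqr_sqrtr// addr_ge0// sqr_ge0. Qed.

(** The difference of the two sides is |z1 - z2|^2. *)
Lemma sqr_normcD_le z1 z2 :
  normc (z1 + z2) ^+ 2 <= 2 * normc z1 ^+ 2 + 2 * normc z2 ^+ 2.
Proof.
rewrite !sqr_normcE; case: z1 z2 => [a b] [a' b'] /=.
by have := sqr_ge0 (a - a'); have := sqr_ge0 (b - b'); lra.
Qed.

Lemma Re_lincomb (c z1 z2 : R[i]) : complex.Re (c * z1 + z2) =
  complex.Re c * complex.Re z1 - complex.Im c * complex.Im z1 + complex.Re z2.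
Proof. by case: c z1 z2 => [a b] [a1 b1] [a2 b2]. Qed.

Lemma Im_lincomb (c z1 z2 : R[i]) : complex.Im (c * z1 + z2) =
  complex.Re c * complex.Im z1 + complex.Im c * complex.Re z1 + complex.Im z2.
Proof. by case: c z1 z2 => [a b] [a1 b1] [a2 b2]. Qed.

Lemma sqr_normc_real (r : R) : normc r%:C ^+ 2 = r ^+ 2.
Proof. by rewrite sqr_normcE /= expr0n addr0. Qed.

End SquaredNormc.

Section ComplexMeasurable.
Context d (T : measurableType d) (R : realType).
Implicit Types (mu : {measure set T -> \bar R}) (f h : T -> R[i]).

Lemma cmeasurable_lincomb (c : R[i]) f h :
  cmeasurable f -> cmeasurable h -> cmeasurable (fun x => c * f x + h x).
Proof.
move=> [rf jf] [rh jh]; split.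
  under eq_fun do rewrite Re_lincomb.
  apply: measurable_funD => //.
  by apply: measurable_funB; apply: measurable_funM => //; exact: measurable_cst.
under eq_fun do rewrite Im_lincomb.
apply: measurable_funD => //.
by apply: measurable_funD; apply: measurable_funM => //; exact: measurable_cst.
Qed.

Lemma cmeasurable_sub f h :
  cmeasurable f -> cmeasurable h -> cmeasurable (fun x => f x - h x).
Proof.
move=> mf mh; have := cmeasurable_lincomb (-1) mh mf.
by under eq_fun do rewrite mulN1r addrC.
Qed.

Lemma cmeasurable_real (u : T -> R) :
  measurable_fun setT u -> cmeasurable (fun x => (u x)%:C).
Proof. by move=> mu; split=> //=; exact: measurable_cst. Qed.

Lemma cmeasurable_scale (u : T -> R) f :
  measurable_fun setT u -> cmeasurable f -> cmeasurable (fun x => (u x)%:C * f x).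
Proof.
move=> mu' [rf jf]; split.
  rewrite (_ : (fun _ => _) = (fun x => u x * complex.Re (f x))); last first.
    by apply/funext => x; case: (f x) => a b /=; rewrite mul0r subr0.
  exact: measurable_funM.
rewrite (_ : (fun _ => _) = (fun x => u x * complex.Im (f x))); last first.
  by apply/funext => x; case: (f x) => a b /=; rewrite mul0r addr0.
exact: measurable_funM.
Qed.

Lemma measurable_sqr_normc f : cmeasurable f ->
  measurable_fun setT (fun x => (normc (f x) ^+ 2)%:E).
Proof.
move=> [rf jf]; apply/measurable_EFinP.
under eq_fun do rewrite sqr_normcE.
by apply: measurable_funD; exact: measurable_funX.
Qed.

Lemma sqr_normc_ge0 (z : R[i]) : (0 <= (normc z ^+ 2)%:E)%E.
Proof. by rewrite lee_fin sqr_ge0. Qed.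

Lemma cLfun2_le mu f h : cmeasurable f -> cLfun 2 mu h ->
  (forall x, normc (f x) ^+ 2 <= normc (h x) ^+ 2) -> cLfun 2 mu f.
Proof.
move=> mf [mh ih] fh; split=> //; apply: le_lt_trans ih.
apply: ge0_le_integral => //.
- by move=> x _; exact: sqr_normc_ge0.
- exact: measurable_sqr_normc.
- exact: measurable_sqr_normc.
- by move=> x _; rewrite lee_fin.
Qed.

Lemma cLfun2_lincomb mu (c : R[i]) f h : cLfun 2 mu f -> cLfun 2 mu h ->
  cLfun 2 mu (fun x => c * f x + h x).
Proof.
move=> [mf fi] [mh hi]; split; first exact: cmeasurable_lincomb.
pose a : R := 2 * normc c ^+ 2.
have a0 : 0 <= a by rewrite mulr_ge0// sqr_ge0.
apply: (@le_lt_trans _ _ (\int[mu]_x (a%:E * (normc (f x) ^+ 2)%:E +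
    2%:E * (normc (h x) ^+ 2)%:E))%E).
  apply: ge0_le_integral => //.
  - by move=> x _; exact: sqr_normc_ge0.
  - by apply: measurable_sqr_normc; exact: cmeasurable_lincomb.
  - by apply: emeasurable_funD; apply: measurable_funeM; exact: measurable_sqr_normc.
  - move=> x _; rewrite -!EFinM -EFinD lee_fin (le_trans (sqr_normcD_le _ _))//.
    by rewrite normcM exprMn mulrA.
rewrite ge0_integralD//; last 4 first.
- by move=> x _; rewrite -EFinM lee_fin mulr_ge0// sqr_ge0.
- by apply: measurable_funeM; exact: measurable_sqr_normc.
- by move=> x _; rewrite -EFinM lee_fin mulr_ge0// sqr_ge0.
- by apply: measurable_funeM; exact: measurable_sqr_normc.
rewrite !ge0_integralZl_EFin//; try exact: measurable_sqr_normc;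
  try by move=> x _; exact: sqr_normc_ge0.
by rewrite lte_add_pinfty// lte_mul_pinfty.
Qed.

Lemma cLfun2_indic mu (B : set T) : measurable B -> (mu B < +oo)%E ->
  cLfun 2 mu (fun x => (\1_B x)%:C).
Proof.
move=> mB Boo; split; first exact: cmeasurable_real.
rewrite (eq_integral (fun x => (\1_B x)%:E)).
  by rewrite integral_indic// setIT.
by move=> x _; rewrite sqr_normc_real indicE; case: (x \in B); rewrite ?expr1n ?expr0n.
Qed.

Lemma ae_eq_sqnorm2 mu f h : cmeasurable f -> cmeasurable h ->
  {ae mu, forall x, f x = h x} -> sqnorm2 mu f = sqnorm2 mu h.
Proof.
move=> mf mh fh; apply: ge0_ae_eq_integral => //.
- exact: measurable_sqr_normc.
- exact: measurable_sqr_normc.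
- by move=> x _; exact: sqr_normc_ge0.
- by move=> x _; exact: sqr_normc_ge0.
- by move: fh; apply: filterS => x fx _; rewrite fx.
Qed.

(** Dominated convergence for the squared moduli; it supplies the L^2-convergence that
    [has_version_lim] asks for. *)
Lemma sqnorm2_cvg0 mu (u : nat -> T -> R[i]) (b : T -> R) :
  (forall n, cmeasurable (u n)) -> mu.-integrable setT (EFin \o b) ->
  (forall n x, normc (u n x) ^+ 2 <= b x) ->
  (forall x, normc (u n x) ^+ 2 @[n --> \oo] --> (0 : R)) ->
  sqnorm2 mu (u n) @[n --> \oo] --> 0%E.
Proof.
move=> mun ib ub u0; rewrite -[X in _ --> X](@integral0 _ _ _ mu setT).
apply: (@dominated_cvg _ _ _ mu _ measurableT _ _ (EFin \o b)) => //.
- by move=> n; exact: measurable_sqr_normc.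
- by move=> x _; apply/fine_cvgP; split; [exact: nearW|exact: u0].
- by move=> n x _ /=; rewrite lee_fin ger0_norm ?sqr_ge0.
Qed.

End ComplexMeasurable.

(** The preimage of a measurable set splits into countably many pieces according to the value of
    [N]. *)
Lemma measurable_select d (X : measurableType d) d' (Y : measurableType d')
    (N : X -> nat) (u : nat -> X -> Y) :
  (forall n, measurable (N @^-1` [set n])) ->
  (forall n, measurable_fun setT (u n)) ->
  measurable_fun setT (fun x => u (N x) x).
Proof.
move=> mN mu _ B mB; rewrite setTI.
rewrite (_ : _ @^-1` B = \bigcup_n (N @^-1` [set n] `&` (u n @^-1` B))).
  apply: bigcup_measurable => n _; apply: measurableI => //.
  by rewrite -[_ @^-1` _]setTI; exact: mu.
apply/seteqP; split=> [x Bx|x [n _ [/= -> //]]].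
by exists (N x).
Qed.

(** The k-th term is at most the tail of the series starting at [k]. *)
Lemma nneseries_cvg0 (R : realType) (a : nat -> \bar R) :
  (forall k, 0 <= a k)%E -> (\sum_(0 <= k <oo) a k < +oo)%E ->
  a k @[k --> \oo] --> 0%E.
Proof.
move=> a0 /nneseries_tail_cvg /(_ (fun k _ => a0 k)) t0.
apply: (@squeeze_cvge _ _ _ _ (cst 0%E) _ _ _ _ _ t0); last exact: cvg_cst.
apply: nearW => k; rewrite a0/=.
have := @nneseries_lim_ge R a xpredT k k.+1 (fun i _ _ => a0 i).
by rewrite big_nat1.
Qed.

(* [F] stands for the Plancherel transform, of which only the isometry and the
   linearity almost everywhere matter here. *)
Section MeasurableVersion.
Context dP dT dS (P : measurableType dP) (T : measurableType dT)
  (S : measurableType dS) (R : realType).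
Variables (mu : {measure set T -> \bar R}) (nu : {measure set S -> \bar R}).
Variable F : (T -> R[i]) -> S -> R[i].
Hypothesis mu_sfinite : sigma_finite setT mu.
Hypothesis F_isometry : forall f, cLfun 2 mu f ->
  cLfun 2 nu (F f) /\ sqnorm2 nu (F f) = sqnorm2 mu f.
Hypothesis F_linear : forall (c : R[i]) f h, cLfun 2 mu f -> cLfun 2 mu h ->
  {ae nu, forall w, F (fun x => c * f x + h x) w = c * F f w + F h w}.
Implicit Types g : P -> T -> R[i].

(** Joint measurability and square integrability are carried along with the version, so that the
    property can be propagated through sums, limits and induction on measurable sets. *)
Definition has_version g := [/\ cmeasurable (fun z : P * T => g z.1 z.2),
  forall p, cLfun 2 mu (g p) &
  exists h : P -> S -> R[i], cmeasurable (fun z : P * S => h z.1 z.2) /\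
    forall p, {ae nu, forall w, h p w = F (g p) w}].

Lemma has_version_lincomb (c : R[i]) g1 g2 : has_version g1 -> has_version g2 ->
  has_version (fun p x => c * g1 p x + g2 p x).
Proof.
move=> [m1 l1 [h1 [mh1 e1]]] [m2 l2 [h2 [mh2 e2]]]; split.
- exact: (cmeasurable_lincomb c m1 m2).
- by move=> p; exact: cLfun2_lincomb.
exists (fun p w => c * h1 p w + h2 p w); split.
  exact: (cmeasurable_lincomb c mh1 mh2).
move=> p; have := F_linear c (l1 p) (l2 p).
by apply: filterS3 (e1 p) (e2 p) => w -> -> ->.
Qed.

(** Linearity almost everywhere with [c] = -1 and both functions 0 reads F 0 = -F 0 + F 0. *)
Lemma F0_ae : {ae nu, forall w, F (fun=> 0) w = 0}.
Proof.
have L0 : cLfun 2 mu (fun=> 0).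
  split; first by split; exact: measurable_cst.
  by rewrite normc0 expr0n/= integral0.
have := F_linear (-1) L0 L0; apply: filterS => w.
rewrite (_ : (fun _ => -1 * 0 + 0) = (fun=> 0)); last by apply/funext => x; rewrite mulr0 addr0.
by rewrite mulN1r addNr.
Qed.

Lemma has_version0 : has_version (fun _ _ => 0).
Proof.
split.
- by split; exact: measurable_cst.
- move=> p; split; first by split; exact: measurable_cst.
  by rewrite normc0 expr0n/= integral0.
exists (fun _ _ => 0); split; first by split; exact: measurable_cst.
by move=> p; apply: filterS F0_ae => w ->.
Qed.

Lemma has_version_sum (I : Type) (s : seq I) (c : I -> R[i]) (g : I -> P -> T -> R[i]) :
  (forall i, has_version (g i)) ->
  has_version (fun p x => \sum_(i <- s) c i * g i p x).
Proof.
move=> vg; elim: s => [|i s IH].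
  by under eq_fun do under eq_fun do rewrite big_nil; exact: has_version0.
under eq_fun do under eq_fun do rewrite big_cons.
exact: has_version_lincomb.
Qed.

Lemma sqnorm2_F_sub f h : cLfun 2 mu f -> cLfun 2 mu h ->
  sqnorm2 nu (fun w => F f w - F h w) = sqnorm2 mu (fun x => f x - h x).
Proof.
move=> lf lh; have l := cLfun2_lincomb (-1) lh lf.
have [[ml _] e] := F_isometry l.
have [[mFf _] _] := F_isometry lf; have [[mFh _] _] := F_isometry lh.
transitivity (sqnorm2 nu (F (fun x => -1 * h x + f x))).
  apply: ae_eq_sqnorm2 => //; first exact: cmeasurable_sub.
  by apply: filterS (F_linear (-1) lh lf) => w ->; rewrite mulN1r addrC.
rewrite e; congr sqnorm2; apply/funext => x.
by rewrite mulN1r addrC.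
Qed.

Lemma ae_cvg_of_summable (H : nat -> S -> R[i]) (phi : S -> R[i]) :
  (forall k, cmeasurable (H k)) -> cmeasurable phi ->
  (forall k, sqnorm2 nu (fun w => H k w - phi w)%R <= (1 / (2 ^ k.+1)%:R)%:E)%E ->
  {ae nu, forall w, normc (H k w - phi w) ^+ 2 @[k --> \oo] --> (0 : R)}.
Proof.
move=> mH mphi Hphi.
pose a k w := (normc (H k w - phi w) ^+ 2)%:E.
have a0 k w : (0 <= a k w)%E by exact: sqr_normc_ge0.
have ma k : measurable_fun setT (a k).
  by apply: measurable_sqr_normc; exact: cmeasurable_sub.
have isum : (\int[nu]_w (\sum_(0 <= k <oo) a k w) < +oo)%E.
  (* fast L^2 convergence: the sum of the squares is integrable, so finite a.e. *)
  rewrite integral_nneseries//.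
  apply: (@le_lt_trans _ _ 1%E); last by rewrite ltry.
  apply: (le_trans _ (epsilon_trick0 xpredT (@ler01 R))).
  apply: lee_nneseries => [k _ _|k _]; first exact: integral_ge0.
  exact: Hphi.
have : nu.-integrable setT (fun w => \sum_(0 <= k <oo) a k w)%E.
  apply/integrableP; split; first exact: ge0_emeasurable_sum.
  under eq_integral => w _ do rewrite gee0_abs ?nneseries_ge0//.
  exact: isum.
move/integrable_ae => /(_ measurableT); apply: filterS => w /(_ I) fw.
have /fine_cvgP[_] : a k w @[k --> \oo] --> 0%E.
  by apply: nneseries_cvg0 => //; rewrite ltey_eq fw.
exact.
Qed.

(* [N k p] is the first index with ||gn - g p||^2 < 2^-(k+1); the versions of
   the functions selected this way converge almost everywhere for each [p]. *)
Lemma has_version_lim (gn : nat -> P -> T -> R[i]) g :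
  (forall n, has_version (gn n)) ->
  cmeasurable (fun z : P * T => g z.1 z.2) -> (forall p, cLfun 2 mu (g p)) ->
  (forall p, sqnorm2 mu (fun x => gn n p x - g p x) @[n --> \oo] --> 0%E) ->
  has_version g.
Proof.
move=> vgn mg lg gng; split=> //.
pose D n p := sqnorm2 mu (fun x => gn n p x - g p x).
have mD n : measurable_fun setT (D n).
  have [mgn _ _] := vgn n.
  apply: (@sigma_finite_fubini_F _ _ _ _ _ _ mu_sfinite
    (fun z => (normc (gn n z.1 z.2 - g z.1 z.2) ^+ 2)%:E)).
    by apply: measurable_sqr_normc; exact: (cmeasurable_sub mgn mg).
  by move=> z; rewrite lee_fin sqr_ge0.
pose e k : R := 1 / (2 ^ k.+1)%:R.
have e0 k : 0 < e k by rewrite divr_gt0// ltr0n expn_gt0.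
pose A k n := [set p | (D n p < (e k)%:E)%E].
have mA k n : measurable (A k n).
  by rewrite -[A k n]setTI; apply: emeasurable_fun_infty_o.
(* [seqDU (A k) n] is [A k n] without the earlier sets, so it contains [p] exactly when [n] is the
   first index that works. *)
have exN k p : exists n, seqDU (A k) n p.
  have : (\bigcup_n A k n) p.
    have : \forall n \near \oo, (D n p < (e k)%:E)%E.
      apply: (gng p [set y | (y < (e k)%:E)%E]).
      by apply: open_nbhs_nbhs; split; [exact: open_ereal_lt_ereal|rewrite /= lte_fin].
    by move=> [n _ /(_ n (leqnn n))]; exists n.
  by rewrite seqDU_bigcup_eq => -[n _]; exists n.
have /choice[N' HN'] : forall kp : nat * P, exists n, seqDU (A kp.1) n kp.2.
  by move=> [k p]; exact: exN.
pose N k p := N' (k, p).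
have HN k p : seqDU (A k) (N k p) p by exact: (HN' (k, p)).
have mN k n : measurable (N k @^-1` [set n]).
  rewrite (_ : _ @^-1` _ = seqDU (A k) n); first exact: seqDU_measurable.
  apply/seteqP; split=> [p <-//|p Ap].
  by apply: (@trivIset_seqDU _ (A k) _ _ I I); exists p.
have /choice[h Hh] : forall n, exists h : P -> S -> R[i],
    cmeasurable (fun z : P * S => h z.1 z.2) /\
    forall p, {ae nu, forall w, h p w = F (gn n p) w}.
  by move=> n; have [] := vgn n.
pose H k p w := h (N k p) p w.
have mH k : cmeasurable (fun z : P * S => H k z.1 z.2).
  have mN1 n : measurable ((fun z : P * S => N k z.1) @^-1` [set n]).
    rewrite [X in measurable X](_ : _ = (N k @^-1` [set n]) `*` setT).
      exact: measurableX.
    by apply/seteqP; split=> [z|z []].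
  split.
    apply: (@measurable_select _ _ _ _ (fun z : P * S => N k z.1)
       (fun n z => complex.Re (h n z.1 z.2))) => // n.
    exact: (Hh n).1.1.
  apply: (@measurable_select _ _ _ _ (fun z : P * S => N k z.1)
    (fun n z => complex.Im (h n z.1 z.2))) => // n.
  exact: (Hh n).1.2.
(* The upper limit is defined for every sequence and depends measurably on it; it equals the limit
   where there is one, and [fine] turns infinite values into 0. *)
pose L (u : nat -> R) : R := fine (limn_esup (EFin \o u)).
have LE u l : u k @[k --> \oo] --> l -> L u = l.
  move=> ul; have ul' : (EFin \o u) k @[k --> \oo] --> l%:E.
    by apply/fine_cvgP; split; [exact: nearW|exact: ul].
  rewrite /L is_cvg_limn_esupE; last by apply/cvg_ex; exists l%:E.
  by rewrite (cvg_lim _ ul')//; exact: ereal_hausdorff.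
exists (fun p w => L (fun k => complex.Re (H k p w)) +i* L (fun k => complex.Im (H k p w))).
split.
  split; rewrite /=.
    apply: measurableT_comp => //; apply: measurable_fun_limn_esup => k.
    by apply/measurable_EFinP; exact: (mH k).1.
  apply: measurableT_comp => //; apply: measurable_fun_limn_esup => k.
  by apply/measurable_EFinP; exact: (mH k).2.
move=> p; pose f k := F (gn (N k p) p).
have [[mphi _] _] := F_isometry (lg p).
have lgn k : cLfun 2 mu (gn (N k p) p) by have [_] := vgn (N k p).
have mf k : cmeasurable (f k) by have [[]] := F_isometry (lgn k).
have fphi k : (sqnorm2 nu (fun w => f k w - F (g p) w)%R <= (e k)%:E)%E.
  rewrite sqnorm2_F_sub//; apply: ltW.
  by have [] := HN k p.
(* With [p] fixed, there is one null set for each [k], hence countably many. *)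
have Hf : {ae nu, forall w, forall k, H k p w = f k w}.
  by apply: ae_foralln => k; exact: (Hh (N k p)).2.
have := ae_cvg_of_summable mf mphi fphi.
apply: filterS2 Hf => w Hf cf.
have sq0 (u : nat -> R) : (forall k, u k ^+ 2 <= normc (f k w - F (g p) w) ^+ 2) ->
    u k @[k --> \oo] --> (0 : R).
  move=> uf; apply/cvgr0Pnorm_lt => eps eps0.
  have /cvgr0Pnorm_lt/(_ (eps ^+ 2)) := cf.
  rewrite exprn_gt0// => /(_ isT); apply: filterS => k.
  rewrite ger0_norm ?sqr_ge0// => /(le_lt_trans (uf k)).
  by rewrite -real_normK ?num_real// ltr_pXn2r// ?nnegrE// ltW.
rewrite [RHS](_ : _ = complex.Re (F (g p) w) +i* complex.Im (F (g p) w)); last by case: (F _ _).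
congr (_ +i* _); apply: LE; apply/subr_cvg0/sq0 => k; rewrite Hf sqr_normcE.
  by rewrite raddfB/= lerDl sqr_ge0.
by rewrite -raddfB/= lerDr sqr_ge0.
Qed.

(** The transform of 1_B multiplied by 1_A(p) is a version: where 1_A(p) vanishes so does the
    family, and F 0 is 0 almost everywhere. *)
Lemma has_version_rectangle (A : set P) (B : set T) :
  measurable A -> measurable B -> (mu B < +oo)%E ->
  has_version (fun p x => (\1_A p * \1_B x)%:C).
Proof.
move=> mA mB Boo; have LB := cLfun2_indic mB Boo.
have mA1 d (Y : measurableType d) : measurable_fun setT (fun z : P * Y => \1_A z.1 : R).
  exact: measurableT_comp.
split.
- apply: cmeasurable_real; apply: measurable_funM; first exact: mA1.
  exact: measurableT_comp.
- move=> p; apply: (cLfun2_le _ LB).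
    by apply: cmeasurable_real; apply: measurable_funM => //; exact: measurable_cst.
  by move=> x; rewrite !sqr_normc_real exprMn ler_piMl ?sqr_ge0.
have [[[rF jF] _] _] := F_isometry LB.
exists (fun p w => (\1_A p)%:C * F (fun x => (\1_B x)%:C) w); split.
  apply: (@cmeasurable_scale _ _ _ (fun z => \1_A z.1)
    (fun z : P * S => F (fun x => (\1_B x)%:C) z.2)); first exact: mA1.
  by split; [exact: (measurableT_comp rF)|exact: (measurableT_comp jF)].
move=> p; rewrite indicE; case: (p \in A).
  rewrite (_ : (fun x => _) = (fun x => (\1_B x)%:C)); last first.
    by apply/funext => x; rewrite mul1r.
  by apply: nearW => w; rewrite mul1r.
have -> : (fun x : T => (false%:R * \1_B x)%:C) = (fun=> 0 : R[i]).
  by apply/funext => x; rewrite mul0r.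
by apply: filterS F0_ae => w ->; exact: mul0r.
Qed.

(** Rectangles form a pi-system generating the product sigma-algebra, and the sets [A] with the
    property form a lambda-system: proper differences by linearity, increasing unions by L^2-limits.
    The factor 1_B keeps all functions in L^2 and dominates the limits. *)
Lemma has_version_indic (B : set T) : measurable B -> (mu B < +oo)%E ->
  forall A : set (P * T), measurable A ->
  has_version (fun p x => (\1_A (p, x) * \1_B x)%:C).
Proof.
move=> mB Boo A mA; have LB := cLfun2_indic mB Boo.
suff: (@measurable _ (P * T)%type) `<=` [set A | measurable A /\
    has_version (fun p x => (\1_A (p, x) * \1_B x)%:C)] by move=> /(_ _ mA)[].
rewrite [X in X `<=` _]measurable_prod_measurableType.
have eqv g1 g2 : has_version g1 -> (forall p x, g1 p x = g2 p x) -> has_version g2.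
  by move=> + g12; rewrite (_ : g1 = g2)//; apply/funext => p; exact/funext.
have mind (A' : set (P * T)) : measurable A' ->
    measurable_fun setT (fun z : P * T => \1_A' (z.1, z.2) : R).
  move=> mA'; rewrite (_ : (fun _ => _) = \1_A'); first exact: measurable_indic.
  by apply/funext => -[].
have mind2 (A' : set (P * T)) (p : P) : measurable A' ->
    measurable_fun setT (fun x : T => \1_A' (p, x) : R).
  by move=> mA'; exact: (measurable_fun_pair2 p (measurable_indic mA')).
apply: lambda_system_subset => //.
- move=> _ _ [A1 mA1 [A2 mA2 <-]] [B1 mB1 [B2 mB2 <-]].
  exists (A1 `&` B1); first exact: measurableI.
  exists (A2 `&` B2); first exact: measurableI.
  by rewrite setXI.
- split=> //.
  + split=> //; apply: (eqv _ _ (has_version_rectangle (@measurableT _ P) mB Boo)) => p x.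
    by rewrite !indicT.
  + move=> A1 A2 A21 [mA1 vA1] [mA2 vA2]; split; first exact: measurableD.
    apply: (eqv _ _ (has_version_lincomb (-1) vA2 vA1)) => p x.
    rewrite mulN1r addrC -raddfB -mulrBl; congr (_ * _)%:C.
    rewrite !indicE in_setD; case: (boolP ((p, x) \in A2)) => [|_]; last by rewrite andbT subr0.
    by move=> /set_mem/A21/mem_set ->; rewrite subrr.
  + move=> Fn ndF mvF; split; first by apply: bigcup_measurable => k _; exact: (mvF k).1.
    have mU : measurable (\bigcup_k Fn k) by apply: bigcup_measurable => k _; exact: (mvF k).1.
    apply: (has_version_lim (fun n => (mvF n).2)).
    * apply: cmeasurable_real; apply: measurable_funM; first exact: mind.
      exact: measurableT_comp.
    * move=> p; apply: (cLfun2_le _ LB).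
        apply: cmeasurable_real; apply: measurable_funM => //.
        exact: mind2.
      by move=> x; rewrite !sqr_normc_real exprMn ler_piMl ?sqr_ge0.
    * move=> p; apply: (@sqnorm2_cvg0 _ _ _ _ _ \1_B) => [n||n x|x].
      - apply: cmeasurable_sub; apply: cmeasurable_real; apply: measurable_funM => //.
          exact: (mind2 _ _ (mvF n).1).
        exact: mind2.
      - apply/integrableP; split; first exact/measurable_EFinP.
        under eq_integral do rewrite gee0_abs ?lee_fin//.
        by rewrite integral_indic// setIT.
      - rewrite -raddfB sqr_normc_real !indicE.
        by do 3 case: (_ \in _); rewrite ?mul0r ?mul1r ?subrr ?subr0 ?sub0r ?sqrrN ?expr1n ?expr0n.
      (* The sets [Fn n] increase, so at each point their indicators are eventually constant. *)
      - apply: cvg_near_cst.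
        have [[k _ Fk]|nF] := pselect ((\bigcup_k Fn k) (p, x)).
          exists k => // n kn.
          have Fnx : Fn n (p, x) by have /subsetPset := ndF _ _ kn; apply.
          have Ux : (\bigcup_k Fn k) (p, x) by exists k.
          by rewrite !indicE (mem_set Fnx) (mem_set Ux) subrr normc0 expr0n.
        have nFn n : ~ Fn n (p, x) by move=> Fnx; apply: nF; exists n.
        apply: nearW => n; rewrite !indicE (memNset nF) (memNset (nFn n)).
        by rewrite subrr normc0 expr0n.
- move=> _ [A1 mA1 [A2 mA2 <-]]; split; first exact: measurableX.
  have BA2oo : (mu (A2 `&` B) < +oo)%E.
    apply: le_lt_trans Boo; apply: le_measure; rewrite ?inE//; exact: measurableI.
  apply: (eqv _ _ (has_version_rectangle mA1 (measurableI _ _ mA2 mB) BA2oo)) => p x.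
  by rewrite !indicE in_setI in_setX/=; case: (p \in A1); case: (x \in A2); rewrite ?(mul1r,mul0r).
Qed.

Import HBNNSimple.

(** Simple functions increasing to [u], cut off to sets [B n] of finite measure that exhaust the
    space, are linear combinations of the indicators just treated. They lie between 0 and [u], so
    they converge in L^2 with the square of [u] as dominating function. *)
Lemma has_version_nonneg (u : P * T -> R) :
  measurable_fun setT u -> (forall z, 0 <= u z) ->
  (forall p, cLfun 2 mu (fun x => (u (p, x))%:C)) ->
  has_version (fun p x => (u (p, x))%:C).
Proof.
move=> mu' u0 lu; have /sigma_finiteP[B [BT ndB mB]] := mu_sfinite.
have mEu : measurable_fun setT (EFin \o u) by exact/measurable_EFinP.
pose f := nnsfun_approx measurableT mEu.
have fu n z : f n z <= u z.
  rewrite -lee_fin nnsfun_approxE; apply: (le_approx n) => // z' _.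
  by rewrite lee_fin.
have f0 n z : 0 <= f n z by [].
have fB n z : 0 <= f n z * \1_(B n) z.2 <= u z.
  rewrite indicE mulr_ge0//= (le_trans _ (fu n z))// ler_piMr//.
  by case: (_ \in _).
apply: (@has_version_lim (fun n p x => (f n (p, x) * \1_(B n) x)%:C)).
- move=> n.
  have := has_version_sum (finmap.enum_fset (fset_set (range (f n)))) (fun y => y%:C)
    (fun y => has_version_indic (mB n).1 (mB n).2
      (measurable_funPTI (f n) (measurable_set1 y))).
  congr has_version; apply/funext => p; apply/funext => x.
  have fE : f n (p, x) = \sum_(y <- finmap.enum_fset (fset_set (range (f n))))
      y * \1_(f n @^-1` [set y]) (p, x) by rewrite fimfunE fsbig_finite.
  rewrite [in RHS]fE mulr_suml rmorph_sum/=.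
  by apply: eq_bigr => y _; rewrite -[in RHS]mulrA [RHS]rmorphM.
- apply: cmeasurable_real; rewrite (_ : (fun _ => _) = u)//.
  by apply/funext => -[].
- exact: lu.
- move=> p; have [[mup _] iup] := lu p; rewrite /= in mup.
  apply: (@sqnorm2_cvg0 _ _ _ _ _ (fun x => u (p, x) ^+ 2)).
  + move=> n; apply: cmeasurable_sub; apply: cmeasurable_real => //.
    apply: measurable_funM; last first.
      by apply: measurable_indic; exact: (mB n).1.
    by apply: measurableT_comp.
  + apply/integrableP; split.
      by apply/measurable_EFinP; exact: measurable_funX.
    rewrite (eq_integral (fun x => (normc (u (p, x))%:C ^+ 2)%:E)).
      exact: iup.
    by move=> x _; rewrite sqr_normc_real /= ger0_norm ?sqr_ge0.
  + move=> n x; rewrite -raddfB sqr_normc_real.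
    have /andP[a0 au] := fB n (p, x).
    by rewrite -sqrrN opprB ler_pXn2r ?nnegrE ?subr_ge0// gerBl.
  + move=> x.
    (* From the index [n0] on, the cut-off factor equals 1 at [x]. *)
    have [n0 _ Bn0] : (\bigcup_n B n) x by rewrite -BT.
    have fc : f n (p, x) @[n --> \oo] --> u (p, x).
      have /fine_cvgP[_] := @cvg_nnsfun_approx _ _ _ _ measurableT _ mEu
         (fun z _ => u0 z) (p, x) I.
      exact.
    under eq_fun do rewrite -raddfB sqr_normc_real.
    apply: (@cvg_trans _ ((f n (p, x) - u (p, x)) ^+ 2 @[n --> \oo])).
      apply: near_eq_cvg; exists n0 => // n /= n0n.
      rewrite indicE mem_set ?mulr1//.
      by have /subsetPset := ndB _ _ n0n; exact.
    have h : (f n (p, x) - u (p, x)) @[n --> \oo] --> (0 : R) by exact/subr_cvg0.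
    have h2 := cvgM h h; rewrite -(mulr0 (0 : R)); exact: h2.
Qed.

(** The positive and negative parts of the real and imaginary parts are bounded by |g|, so each lies
    in L^2 for every [p]; linearity reassembles them. *)
Lemma measurable_version_exists g :
  cmeasurable (fun z : P * T => g z.1 z.2) -> (forall p, cLfun 2 mu (g p)) ->
  has_version g.
Proof.
move=> [rg jg] lg.
have part (u : P * T -> R) : measurable_fun setT u -> (forall z, 0 <= u z) ->
    (forall z, u z ^+ 2 <= normc (g z.1 z.2) ^+ 2) ->
    has_version (fun p x => (u (p, x))%:C).
  move=> mu' u0 ug; apply: has_version_nonneg => // p.
  apply: (cLfun2_le _ (lg p)) => [|x].
    by apply: cmeasurable_real; exact: measurableT_comp.
  by rewrite sqr_normc_real; exact: (ug (p, x)).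
pose rp z := Num.max (complex.Re (g z.1 z.2)) 0.
pose rn z := Num.max (- complex.Re (g z.1 z.2)) 0.
pose ip z := Num.max (complex.Im (g z.1 z.2)) 0.
pose im z := Num.max (- complex.Im (g z.1 z.2)) 0.
have maxsq (a b : R) : Num.max a 0 ^+ 2 <= a ^+ 2 + b ^+ 2.
  have := sqr_ge0 a; have := sqr_ge0 b.
  by case: (leP a 0) => _; rewrite ?expr0n/=; lra.
have mmax (v : P * T -> R) : measurable_fun setT v -> measurable_fun setT (fun z => Num.max (v z) 0).
  by move=> mv; apply: measurable_maxr => //; exact: measurable_cst.
have mopp (v : P * T -> R) : measurable_fun setT v -> measurable_fun setT (fun z => - v z).
  by move=> mv; exact: measurableT_comp.
have max0 (a : R) : 0 <= Num.max a 0 by rewrite le_max lexx orbT.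
have vrp : has_version (fun p x => (rp (p, x))%:C).
  by apply: part => [|z|z]; [exact: mmax|exact: max0|rewrite sqr_normcE; exact: maxsq].
have vrn : has_version (fun p x => (rn (p, x))%:C).
  by apply: part => [|z|z]; [exact: (mmax _ (mopp _ _))|exact: max0|rewrite sqr_normcE -(sqrrN (complex.Re _)); exact: maxsq].
have vip : has_version (fun p x => (ip (p, x))%:C).
  by apply: part => [|z|z]; [exact: mmax|exact: max0|rewrite sqr_normcE addrC; exact: maxsq].
have vim : has_version (fun p x => (im (p, x))%:C).
  by apply: part => [|z|z]; [exact: (mmax _ (mopp _ _))|exact: max0|rewrite sqr_normcE -(sqrrN (complex.Im _)) addrC; exact: maxsq].
have := has_version_lincomb 'i (has_version_lincomb (-1) vim vip)
  (has_version_lincomb (-1) vrn vrp).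
congr has_version; apply/funext => p; apply/funext => x.
have maxB (a : R) : Num.max a 0 - Num.max (- a) 0 = a.
  by case: (leP a 0); case: (leP (- a) 0); lra.
rewrite !mulN1r -!(addrC _ (- _)) -!raddfB !maxB addrC.
by case: (g p x) => a b /=; simpc.
Qed.

End MeasurableVersion.

(** * Haar measures and the main estimate *)

Section Borel.
Variable T : PreTopologicalZmodule.type.

Lemma open_borel_measurable (U : set T) : open U -> measurable (U : set (borel T)).
Proof. by move=> oU; exact: sub_gen_smallest. Qed.

Lemma closed_borel_measurable (A : set T) : closed A -> measurable (A : set (borel T)).
Proof.
by move=> cA; rewrite -[A]setCK; apply: (@measurableC _ (borel T)); apply: open_borel_measurable; exact: closed_openC.
Qed.

Lemma compact_borel_measurable (K : set T) : hausdorff_space T -> compact K ->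
  measurable (K : set (borel T)).
Proof. by move=> hT cK; apply: closed_borel_measurable; exact: compact_closed. Qed.

Lemma continuous_borel_measurable (T' : PreTopologicalZmodule.type) (f : T -> T') :
  continuous f -> measurable_fun setT (f : borel T -> borel T').
Proof.
move=> /continuousP cf.
apply: (measurability (@open T' : set (set (borel T')))) => // _ [U oU <-].
by rewrite setTI; apply: open_borel_measurable; exact: cf.
Qed.

Variables (R : realType) (mu : {measure set (borel T) -> \bar R}).
Hypothesis mu_haar : haar_measure mu.

(** Every point has a compact neighbourhood, which has finite measure and contains a member of the
    countable base around the point. *)
Lemma haar_sigma_finite : @second_countable T -> locally_compact [set: T] ->
  sigma_finite (setT : set (borel T)) mu.
Proof.
have [_ _ cfin _ _] := mu_haar.
move=> [B /countable_injP[c cinj] [Bo Bx]] lc.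
have Boo U : B U -> measurable (U : set (borel T)).
  by move=> BU; apply: open_borel_measurable; exact: Bo.
(* Since [c] is injective on the base, [D n] holds at most one set and its union is that set or
   empty. *)
pose D n := [set U : set T | [/\ B U, (mu U < +oo)%E & c U = n]].
exists (fun n => \bigcup_(U in D n) U).
  apply/seteqP; split=> // x _.
  have [K] := lc (x : T) I; rewrite withinET => nK [cK clK].
  have [U [BU Ux] UK] := Bx x K nK.
  exists (c U) => //; exists U => //; split=> //.
  apply: (le_lt_trans _ (cfin K cK)); apply: le_measure => //; rewrite inE.
    exact: Boo.
  exact: closed_borel_measurable.
move=> n; have [[U DU]|nD] := pselect (exists U, D n U).
  rewrite (_ : \bigcup_(V in D n) V = U).
    by have [BU Uoo _] := DU; split; [exact: Boo|].
  apply/seteqP; split=> [x [V [BV _ cV] Vx]|x Ux]; last by exists U.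
  have [BU _ cU] := DU.
  by rewrite (_ : U = V)//; apply: cinj; rewrite ?inE// cU cV.
rewrite (_ : \bigcup_(V in D n) V = set0); first by rewrite measure0.
by rewrite -subset0 => x [V DV _]; apply: nD; exists V.
Qed.

(* Inner regularity is only available on open sets, so [Q] is first enclosed in
   an open set [V] with [mu (V `\` Q)] small. *)
Lemma haar_locally_null (Q : set T) (F : set (set T)) : hausdorff_space T ->
  measurable (Q : set (borel T)) -> (mu Q < +oo)%E ->
  (forall U, F U -> open U /\ mu.-negligible (Q `&` U)) ->
  mu.-negligible (Q `&` \bigcup_(U in F) U).
Proof.
move=> hT mQ Qoo FU; have [_ _ _ outer inner] := mu_haar.
set W := \bigcup_(U in F) U.
have oW : open W by apply: bigcup_open => U /FU[].
have mQW : measurable (Q `&` W : set (borel T)).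
  by apply: measurableI => //; exact: open_borel_measurable.
apply/negligibleP => //; apply/eqP; rewrite eq_le measure_ge0 andbT.
apply/lee_addgt0Pr => e e0; rewrite add0e.
have Qfin : mu Q \is a fin_num by rewrite ge0_fin_numE.
have [|_ [V [oV QV] <-]] := @lb_ereal_inf_adherent R
  [set mu U | U in [set U : set T | open U /\ Q `<=` U]] e e0.
  by rewrite -outer.
rewrite -outer// => Ve.
have mV := open_borel_measurable oV.
have VQ : (mu (V `\` Q) <= e%:E)%E.
  have : (mu V = mu (V `\` Q) + mu Q)%E.
    by rewrite -[X in (_ + mu X)%E](setIidr QV); exact: measureDI.
  move=> VE; rewrite VE addeC in Ve; apply: ltW.
  by rewrite -(@lteD2lE _ (mu Q)).
(* A compact subset of the open set W & V is covered by finitely many members of [F], so it meets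
   [Q] in a null set and its measure is that of its part in V - Q. *)
have WV : (mu (W `&` V) <= e%:E)%E.
  rewrite inner; last exact: openI.
  apply: ge_ereal_sup => _ [L [cL LWV] <-].
  have mL := compact_borel_measurable hT cL.
  have LQ0 : mu (L `&` Q) = 0%E.
    apply: measure_negligible; first exact: measurableI.
    have exN x : exists N : set T, L x -> F N /\ N x.
      have [Lx|nLx] := pselect (L x); last by exists set0.
      by have [[U FU' Ux] _] := LWV x Lx; exists U.
    have [N HN] := choice exN.
    have [x Lx|D [fD DL LD]] := @compact_nbhs_cover T L N cL.
      have [FN Nx] := HN x Lx; apply: open_nbhs_nbhs; split=> //.
      exact: (FU _ FN).1.
    have neg : mu.-negligible (\bigcup_(x in D) (Q `&` N x) : set (borel T)).
      move: fD DL => /finite_fsetP[X ->] XL; rewrite bigcup_fset.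
      rewrite big_seq; elim/big_ind: _ => [|A1 A2|x xX].
      - exact: negligible_set0.
      - exact: negligibleU.
      - by have [/FU[]] := HN x (XL x xX).
    apply: negligibleS neg.
    by move=> x [Lx Qx]; have [y Dy Nx] := LD x Lx; exists y.
  have -> : mu L = mu (L `\` Q) by rewrite -[RHS]adde0 -LQ0; exact: measureDI.
  apply: le_trans VQ.
  apply: le_measure; rewrite ?inE; [exact: measurableD|exact: measurableD|].
  by apply: setSD => x /LWV[].
apply: le_trans WV; apply: le_measure; rewrite ?inE//.
  by apply: open_borel_measurable; exact: openI.
by move=> x [Qx Wx]; split=> //; exact: QV.
Qed.

End Borel.

(** The exceptional set is the translate by [- a] of the original one, and [nu] is translation
    invariant. *)
Lemma haar_negligible_shift (R : realType) (G : topologicalZmodType)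
    (nu : {measure set (borel (pdual R G)) -> \bar R}) (a : pdual R G)
    (P : pdual R G -> Prop) : haar_measure nu ->
  {ae nu, forall w, P w} -> {ae nu, forall w : pdual R G, P (w + a)}.
Proof.
move=> [_ inv _ _ _] [N [mN N0 PN]].
have NE : (fun w : pdual R G => w + a) @^-1` N =
    [set (- a + x : pdual R G) | x in (N : set (borel (pdual R G)))].
  apply/seteqP; split=> [w Nwa|_ [x Nx <-]].
    by exists (w + a) => //; rewrite addrCA addNr addr0.
  by rewrite /= addrAC addNr add0r.
exists ((fun w : pdual R G => w + a) @^-1` N); split.
- rewrite -[X in measurable X]setTI.
  exact: (continuous_borel_measurable (@pdual_addr_continuous R G a)).
- by rewrite NE inv.
- by move=> w; exact: PN.
Qed.

(** Indexing by codes, with 0 at integers that code nothing, makes results on series over the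
    integers available. *)
Lemma esum_countType (R : realType) (J : countType) (a : J -> \bar R) :
  (forall j, 0 <= a j)%E -> (\esum_(j in [set: J]) a j =
    \sum_(0 <= n <oo) oapp a 0 (pickle_inv n : option J))%E.
Proof.
move=> a0; set b := fun n => oapp a 0%E (pickle_inv n : option J).
have b0 n : (0 <= b n)%E by rewrite /b; case: pickle_inv.
rewrite nneseries_esumT//.
transitivity (\esum_(n in range (@pickle J)) b n)%E.
  rewrite (@reindex_esum _ J nat setT _ pickle).
    by apply: eq_esum => j _; rewrite /b pickleK_inv.
  by split=> [j _|j k _ _ /(pcan_inj (@pickleK_inv J))|]//; exists j.
rewrite esum_mkcond; apply: eq_esum => n _.
case: ifPn => // /negP nr; rewrite /b; case E : (pickle_inv n) => [j|//].
by exfalso; apply: nr; rewrite inE; exists j => //; have := @pickle_invK J n; rewrite E.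
Qed.

(** * Tonelli's theorem over a set of finite measure *)

Section Restriction.
Context d d' (X : measurableType d) (Y : measurableType d') (R : realType).
Variables (m1 : {sigma_finite_measure set X -> \bar R}).
Variables (nu : {measure set Y -> \bar R}) (Q : set Y).
Hypotheses (mQ : measurable Q) (Qoo : (nu Q < +oo)%E).
Variable f : X * Y -> \bar R.
Hypotheses (mf : measurable_fun setT f) (f0 : forall z, (0 <= f z)%E).

Let fQ (z : X * Y) := ((f z) * (\1_Q z.2)%:E)%E.

Let mfQ : measurable_fun setT fQ.
Proof.
apply: emeasurable_funM => //; apply/measurable_EFinP.
exact: measurableT_comp.
Qed.

Let fQ0 z : (0 <= fQ z)%E.
Proof. by rewrite mule_ge0// lee_fin indicE. Qed.

(** The restriction of [nu] to [Q] is a finite measure, to which Tonelli applies; the indicator lets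
    the integral run over the whole space. *)
Lemma integral_mfrestr (g : Y -> \bar R) :
  (\int[nu]_(y in Q) g y = \int[mfrestr mQ Qoo]_y (g y * (\1_Q y)%:E))%E.
Proof.
rewrite (@eq_measure_integral _ _ _ Q (mfrestr mQ Qoo)); last first.
  by move=> A mA AQ; rewrite -[A in LHS](setIidl AQ).
rewrite integral_mkcond; apply: eq_integral => y _.
by rewrite patchE indicE; case: (y \in Q); rewrite ?mule1 ?mule0.
Qed.

Lemma measurable_integral_restr : measurable_fun setT (fun x => \int[nu]_(y in Q) f (x, y))%E.
Proof.
under eq_fun do rewrite integral_mfrestr.
exact: (@measurable_fun_fubini_tonelli_F _ _ _ _ _ (mfrestr mQ Qoo) fQ).
Qed.

Lemma fubini_restr : (\int[m1]_x \int[nu]_(y in Q) f (x, y) =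
  \int[nu]_(y in Q) \int[m1]_x f (x, y))%E.
Proof.
have FE x : (\int[nu]_(y in Q) f (x, y) = \int[mfrestr mQ Qoo]_y fQ (x, y))%E.
  exact: integral_mfrestr.
rewrite integral_mfrestr (eq_integral _ _ (fun x _ => FE x)).
rewrite (@fubini_tonelli _ _ _ _ _ m1 (mfrestr mQ Qoo) fQ)//.
apply: eq_integral => y _; rewrite /fQ/= indicE; case: (y \in Q).
  by rewrite mule1; apply: eq_integral => x _; rewrite mule1.
by rewrite mule0 -[RHS](@integral0 _ _ _ m1 setT); apply: eq_integral => x _; rewrite mule0.
Qed.

End Restriction.

Lemma esum_finite_support (R : realType) (I : choiceType) (D A : set I)
    (a : I -> \bar R) : finite_set A -> A `<=` D -> (forall i, 0 <= a i)%E ->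
  (forall i, D i -> ~ A i -> a i = 0%E) ->
  (\esum_(i in D) a i = \sum_(i \in A) a i)%E.
Proof.
move=> fA AD a0 aA; rewrite -esum_fset// esum_mkcond [RHS]esum_mkcond.
apply: eq_esum => i _; case: (boolP (i \in A)) => [|iA].
  by move=> /set_mem/AD/mem_set ->.
by case: ifPn => // /set_mem Di; apply: aA => //; rewrite notin_setE in iA.
Qed.

(** * Integrals over Q weighted by translates of 1_Q *)

Section ShiftedIntegrals.
Variables (R : realType) (G : topologicalZmodType).
Variable nu : {measure set (borel (pdual R G)) -> \bar R}.
Hypothesis nu_haar : haar_measure nu.
Variable Q : set (pdual R G).
Hypothesis cQ : compact Q.
Implicit Types (a w : pdual R G) (k : pdual R G -> R[i]).

Let mQ : measurable (Q : set (borel (pdual R G))).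
Proof. exact: (compact_borel_measurable (@pdual_hausdorff R G)). Qed.

Lemma measurable_addr a :
  measurable_fun setT ((fun w => w + a) : borel (pdual R G) -> borel (pdual R G)).
Proof. by apply: continuous_borel_measurable; exact: pdual_addr_continuous. Qed.

Lemma measurable_indic_shift a :
  measurable_fun setT ((fun w => (\1_Q (w + a))%:E) : borel (pdual R G) -> \bar R).
Proof.
apply/measurable_EFinP.
exact: (measurableT_comp (measurable_indic (mQ : measurable (Q : set (borel (pdual R G))))) (measurable_addr a)).
Qed.

Lemma measurable_shifted_integrand a k : cmeasurable (k : borel (pdual R G) -> _) ->
  measurable_fun setT ((fun w => (\1_Q (w + a))%:E * (normc (k w) ^+ 2)%:E)%E
    : borel (pdual R G) -> \bar R).
Proof.
move=> mk; apply: emeasurable_funM; first exact: measurable_indic_shift.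
exact: (measurable_sqr_normc mk).
Qed.

(** Null sets are stable under translation, so F1(w + a) is 1_Q(w + a) almost everywhere, and [S]
    differs from [Q] by a null set. With [k] a section of a jointly measurable version, the right
    side becomes accessible to Tonelli. *)
Lemma shifted_integralE (S : set (pdual R G)) a (F1 F2 k : pdual R G -> R[i]) :
  measurable (S : set (borel (pdual R G))) -> S `<=` Q ->
  nu.-negligible (Q `\` S) ->
  cmeasurable (F1 : borel (pdual R G) -> _) ->
  cmeasurable (F2 : borel (pdual R G) -> _) ->
  cmeasurable (k : borel (pdual R G) -> _) ->
  {ae nu, forall w, F1 w = (\1_Q w)%:C} -> {ae nu, forall w, k w = F2 w} ->
  (\int[nu]_(w in S) ((normc (F1 (w + a) * F2 w)%R ^+ 2)%:E) =
   \int[nu]_(w in Q) ((\1_Q (w + a)%R)%:E * (normc (k w) ^+ 2)%:E))%E.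
Proof.
move=> mS SQ QS mF1 mF2 mk F1Q kF2.
rewrite integral_mkcond [RHS]integral_mkcond.
have mF1a : cmeasurable ((fun w => F1 (w + a)) : borel (pdual R G) -> _).
  by split; [exact: (measurableT_comp mF1.1 (measurable_addr a))|
             exact: (measurableT_comp mF1.2 (measurable_addr a))].
apply: ge0_ae_eq_integral => //.
- apply/(measurable_restrictT _ mS); apply: measurable_funTS.
  rewrite (_ : (fun _ => _) = (fun w =>
    (normc (F1 (w + a)) ^+ 2)%:E * (normc (F2 w) ^+ 2)%:E)%E); last first.
    by apply/funext => w; rewrite normcM exprMn EFinM.
  by apply: emeasurable_funM; [exact: (measurable_sqr_normc mF1a)|exact: (measurable_sqr_normc mF2)].
- apply/(measurable_restrictT _ mQ); apply: measurable_funTS.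
  exact: measurable_shifted_integrand.
- by move=> w _; rewrite patchE; case: ifP => // _; exact: sqr_normc_ge0.
- move=> w _; rewrite patchE; case: ifP => // _; apply: mule_ge0; last exact: sqr_normc_ge0.
  by rewrite lee_fin indicE.
have QS' : {ae nu, forall w, ~ (Q `\` S) w}.
  by move: QS => [N [mN N0 QSN]]; exists N; split=> // w /= /contrapT; exact: QSN.
have F1a := haar_negligible_shift a nu_haar F1Q.
apply: (@filterS3 _ _ (ae_filter_ringOfSetsType nu) _ _ _ _ _ QS' F1a kF2) => w nQS F1w kw _.
rewrite !patchE; have [Sw|nSw] := pselect (S w).
  rewrite !mem_set//; last exact: SQ.
  by rewrite F1w normcM exprMn EFinM sqr_normc_real kw indicE; case: (_ \in _);
    rewrite ?expr1n ?expr0n.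
by rewrite !memNset// => Qw; apply: nQS.
Qed.

(** The finite sum moves inside the integral. At a point of [Q] the shifts outside [A] contribute 0,
    so the sum over [A] is the full sum over [D], almost everywhere at least [c]. *)
Lemma le_esum_shifted_integral (D A : set (pdual R G)) (c : R) k : 0 <= c ->
  finite_set A -> A `<=` D ->
  (forall a w, D a -> Q w -> Q (w + a) -> A a) ->
  {ae nu, forall w, Q w -> (c%:E <= \esum_(a in D) (\1_Q (w + a))%:E)%E} ->
  cmeasurable (k : borel (pdual R G) -> _) ->
  (c%:E * \int[nu]_(w in Q) (normc (k w) ^+ 2)%:E <=
    \sum_(a \in A) \int[nu]_(w in Q) ((\1_Q (w + a)%R)%:E * (normc (k w) ^+ 2)%:E))%E.
Proof.
move=> c0 fA AD DA cD mk.
have m2 := measurable_sqr_normc mk.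
rewrite -ge0_integral_fsum//; last 2 first.
- by move=> a; apply: measurable_funTS; exact: measurable_shifted_integrand.
- by move=> a w _; rewrite mule_ge0 ?sqr_normc_ge0// lee_fin indicE.
rewrite -ge0_integralZl_EFin//; last 2 first.
- by move=> w _; exact: sqr_normc_ge0.
- exact: measurable_funTS.
apply: ae_ge0_le_integral => //.
- by move=> w _; rewrite mule_ge0 ?sqr_normc_ge0.
- by apply: measurable_funeM; exact: measurable_funTS.
- move=> w _; apply: fsume_ge0 => a _.
  by apply: mule_ge0; [rewrite lee_fin indicE|exact: sqr_normc_ge0].
- apply: emeasurable_fsum => // a.
  by apply: measurable_funTS; exact: measurable_shifted_integrand.
apply: (@filterS _ _ (ae_filter_ringOfSetsType nu) _ _ _ cD) => w cw Qw.
rewrite -ge0_mule_fsuml; last by move=> a; rewrite lee_fin indicE.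
apply: lee_wpmul2r; first exact: sqr_normc_ge0.
rewrite (le_trans (cw Qw))// (@esum_finite_support _ _ _ A)//.
  by move=> a Da nAa; rewrite indicE memNset// => Qwa; apply: nAa; exact: DA Qwa.
Qed.

End ShiftedIntegrals.

Theorem lemma3p5 (R : realType) (G : topologicalZmodType)
    (G_second_countable : @second_countable G)
    (G_locally_compact : locally_compact [set: G])
    (G_hausdorff : hausdorff_space G)
    (muG : {measure set (borel G) -> \bar R})
    (muG_haar : haar_measure muG)
    (nu : {measure set (borel (pdual R G)) -> \bar R})
    (nu_haar : haar_measure nu)
    (FP : (G -> R[i]) -> pdual R G -> R[i])
    (FP_plancherel : plancherel_transform muG nu FP)
    (J : countType)
    (Gamma : J -> zmodClosed G)
    (Gamma_closed : forall j, closed [set x : G | x \in Gamma j])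
    (Gamma_cocompact : forall j, compact [set: qgroup (Gamma j)])
    (muGamma : forall j, {measure set (borel (subgroup (Gamma j))) -> \bar R})
    (muGamma_haar : forall j, haar_measure (muGamma j))
    (muGamma_lattice : forall j,
       (forall x : subgroup (Gamma j), open [set x]) ->
       forall A : set (borel (subgroup (Gamma j))), measurable A ->
         muGamma j A = counting A)
    (muQ : forall j, {measure set (borel (qgroup (Gamma j))) -> \bar R})
    (muQ_haar : forall j, haar_measure (muQ j))
    (muQ_weil : forall j, weil_formula muG (muGamma j) (muQ j))
    (d : J -> measure_display) (P : forall j, measurableType (d j))
    (muP : forall j, {sigma_finite_measure set (P j) -> \bar R})
    (g : forall j, P j -> G -> R[i])
    (g_L2 : forall j p, cLfun 2 muG (g j p))
    (g_measurable : forall j (U : set (G -> R[i])),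
       <<s cLfun 2 muG, L2_open muG >> U -> measurable (g j @^-1` U))
    (g_jointly_measurable : forall j,
       cmeasurable (fun z : (P j * borel G)%type => g j z.1 z.2))
    (E : set (pdual R G))
    (E_closed : closed E) (E_null : nu E = 0%E)
    (Gamma_perp : forall K : set (pdual R G), compact K -> K `<=` ~` E ->
       exists Q : set (pdual R G), exists C : R,
         [/\ compact Q, K `<=` Q, Q `<=` ~` E, 0 < C
           & forall j,
             (C%:E * covolume (muQ j) <=
              ess_inf_on nu Q (fun w =>
                \esum_(a in annihilator R (Gamma j))
                  (\1_Q (w + a : pdual R G)%R)%:E))%E])
    (LIC : local_integrability muG nu FP E muQ muP g) :
  strictly_temperate nu FP E muP g.

Proof.
have hT := @pdual_hausdorff R G.
have smu := haar_sigma_finite muG_haar G_second_countable G_locally_compact.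
have [Fiso Flin _ Fsurj] := FP_plancherel.
have [_ _ nu_fin _ _] := nu_haar.
split.
  have ex j : exists hj : P j -> pdual R G -> R[i],
      cmeasurable (fun z : (P j * borel (pdual R G))%type => hj z.1 z.2) /\
      forall p, {ae nu, forall w, hj p w = FP (g j p) w}.
    by have [_ _] := measurable_version_exists smu Fiso Flin (g_jointly_measurable j) (g_L2 j).
  exists (fun j => projT1 (cid (ex j))) => j.
  exact: projT2 (cid (ex j)).
move=> h hv K cK KE.
have [Q [C [cQ KQ QE C0 HC]]] := Gamma_perp K cK KE.
have mQ := compact_borel_measurable hT cQ.
have mK := compact_borel_measurable hT cK.
have Qoo := nu_fin Q cQ.
have [f Lf fphi] := Fsurj _ (cLfun2_indic mQ Qoo).
set S := ess_support nu (FP f).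
have SQ : S `<=` Q.
  move=> w Sw; apply: contrapT => nQw; apply: Sw; exists (~` Q) => //; split.
    by apply: closed_openC; exact: compact_closed.
  apply: (@filterS _ _ (ae_filter_ringOfSetsType nu) _ _ _ fphi) => w' -> nQ.
  by rewrite indicE memNset.
have clS : closed S by apply: open_closedC; apply: bigcup_open => U [].
have mS := closed_borel_measurable clS.
(* [Q] minus [S] is the part of [Q] inside a union of open sets on which the transform vanishes
   almost everywhere; as it equals 1 almost everywhere on [Q], each of these meets [Q] in a null
   set. *)
have QS : nu.-negligible (Q `\` S : set (borel (pdual R G))).
  rewrite setDE setCK.
  apply: (haar_locally_null nu_haar hT mQ Qoo) => U [oU U0]; split=> //.
  have neg := @filterS2 _ _ (ae_filter_ringOfSetsType nu) _ _
    (fun w => ~ (Q w /\ U w)) _ U0 fphi.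
  have [|N [mN N0 QN]] := neg.
    move=> w Uw fw [Qw /Uw]; rewrite fw indicE mem_set// => /eqP.
    by rewrite oner_eq0.
  by exists N; split=> // w Qw; apply: QN => /=; apply.
have DEf : D_E muG nu FP E f.
  split=> //.
  - apply: (@le_lt_trans _ _ 1%:E); last by rewrite ltry.
    apply/ess_supP.
    apply: (@filterS _ _ (ae_filter_ringOfSetsType nu) _ _ _ fphi) => w ->.
    by rewrite lee_fin /= expr0n addr0 sqrtr_sqr ger0_norm indicE//; case: (_ \in _).
  - exact: subclosed_compact clS cQ SQ.
  - by move=> w /SQ; exact: QE.
have LICf := LIC f DEf; rewrite -/S in LICf.
(* A nonzero Haar measure on a compact quotient has total mass in (0, +oo), so [fine] loses
   nothing. *)
have cov j : exists2 r : R, 0 < r & covolume (muQ j) = r%:E.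
  have [n0 _ fin _ _] := muQ_haar j.
  have Qfin := fin _ (@Gamma_cocompact j).
  have Q0 : (0 < muQ j setT)%E by rewrite lt_neqAle eq_sym n0 measure_ge0.
  exists (fine (covolume (muQ j))); first by apply: fine_gt0; rewrite Q0.
  by rewrite fineK// ge0_fin_numE// ltW.
have [[mFf _] _] := Fiso _ Lf.
have mh j := (hv j).1.
have mhp j p : cmeasurable (h j p : borel (pdual R G) -> _).
  by split; [exact: (measurable_fun_pair2 p (mh j).1)|exact: (measurable_fun_pair2 p (mh j).2)].
pose A j := [set a | annihilator R (Gamma j) a /\ exists w, Q w /\ Q (w + a)].
have fA j : finite_set (A j) by apply: finite_annihilator_shifts.
pose V j a p := (\int[nu]_(w in Q) ((\1_Q (w + a : pdual R G)%R)%:E *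
   (normc (h j p w) ^+ 2)%:E))%E.
have V0 j a p : (0 <= V j a p)%E.
  apply: integral_ge0 => w _; apply: mule_ge0; last exact: sqr_normc_ge0.
  by rewrite lee_fin indicE.
have LICE j p : (\esum_(a in annihilator R (Gamma j)) \int[nu]_(w in S)
    ((normc (FP f (w + a : pdual R G)%R * FP (g j p) w)%R ^+ 2)%:E) =
    \sum_(a \in A j) V j a p)%E.
  have [[mFg _] _] := Fiso _ (g_L2 j p).
  rewrite -(@esum_finite_support _ _ (annihilator R (Gamma j)) (A j) (fun a => V j a p))//.
  - apply: eq_esum => a _.
    exact: (shifted_integralE nu_haar cQ a mS SQ QS mFf mFg (mhp j p) fphi ((hv j).2 p)).
  - by move=> a [].
  - move=> a Da nAa; rewrite /V -[RHS](@integral0 _ _ _ nu Q).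
    apply: eq_integral => w /set_mem Qw; rewrite indicE memNset ?mul0e// => Qwa.
    by apply: nAa; split=> //; exists w.
pose G0 j p := (\int[nu]_(w in Q) (normc (h j p w) ^+ 2)%:E)%E.
have mn j : measurable_fun setT (fun z : (P j * borel (pdual R G))%type =>
    (normc (h j z.1 z.2) ^+ 2)%:E) by exact: measurable_sqr_normc (mh j).
have mG j : measurable_fun setT (G0 j).
  exact: (measurable_integral_restr mQ Qoo (mn j) (fun z => sqr_normc_ge0 _)).
have G00 j p : (0 <= G0 j p)%E by apply: integral_ge0 => w _; exact: sqr_normc_ge0.
have mV j a : measurable_fun setT (V j a).
  apply: (measurable_integral_restr mQ Qoo (f := fun z : (P j * borel (pdual R G))%type =>
    (\1_Q (z.2 + a : pdual R G)%R)%:E * (normc (h j z.1 z.2) ^+ 2)%:E)%E).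
    apply: emeasurable_funM => //.
    exact: (measurableT_comp (measurable_indic_shift cQ a) measurable_snd).
  move=> z; apply: mule_ge0; last exact: sqr_normc_ge0.
  by rewrite lee_fin indicE.
(* The covolume moves to the left, and the pointwise estimate is applied for each [p] with the
   constant d(Gamma_j) C. *)
have step j : (C%:E * \int[muP j]_p G0 j p <=
    (fine (covolume (muQ j)))^-1%:E * \int[muP j]_p \sum_(a \in A j) V j a p)%E.
  have [r r0 covE] := cov j; rewrite covE /=.
  rewrite -lee_pdivrMl ?invr_gt0// invrK muleA -EFinM.
  rewrite -ge0_integralZl_EFin//; last by rewrite mulr_ge0// ltW.
  apply: ge0_le_integral => //.
  - by move=> p _; rewrite mule_ge0// lee_fin mulr_ge0// ltW.
  - exact: measurable_funeM.
  - exact: emeasurable_fsum.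
  move=> p _; apply: (@le_esum_shifted_integral _ _ _ _ cQ (annihilator R (Gamma j))) => //.
  - by rewrite mulr_ge0// ltW.
  - by move=> a [].
  - by move=> a w Da Qw Qwa; split=> //; exists w.
  (* The essential infimum is a lower bound almost everywhere; on [Q] the function takes the shifted
     sum and not the filler value +oo. *)
  have := HC j; rewrite covE => /ess_infP.
  apply: (@filterS _ _ (ae_filter_ringOfSetsType nu)) => w + Qw.
  by rewrite mem_set// mulrC EFinM.
have IG0 j : (0 <= \int[muP j]_p G0 j p)%E by exact: integral_ge0.
have fin : (\esum_(j in [set: J]) \int[muP j]_p G0 j p < +oo)%E.
  have : (\esum_(j in [set: J]) (C%:E * \int[muP j]_p G0 j p) < +oo)%E.
    apply: le_lt_trans LICf; apply: le_esum => j _.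
    by under [in leRHS]eq_integral do rewrite LICE; exact: step.
  rewrite esum_countType; last by move=> j; rewrite mule_ge0// lee_fin ltW.
  rewrite esum_countType//.
  rewrite (@eq_eseriesr _ _ (fun n => C%:E * oapp (fun j => \int[muP j]_p G0 j p) 0
    (pickle_inv n : option J))%E); last first.
    by move=> n _; case: pickle_inv => //=; rewrite mule0.
  rewrite nneseriesZl; last by move=> n _; case: pickle_inv.
  (* Were the sum infinite, its product with [C] > 0 would be infinite as well. *)
  rewrite !ltey; apply: contra => /eqP ->.
  by rewrite gt0_muley// lte_fin.
pose H j w := (\int[muP j]_p (normc (h j p w) ^+ 2)%:E)%E.
have H0 j w : (0 <= H j w)%E by apply: integral_ge0 => p _; exact: sqr_normc_ge0.
have mH j : measurable_fun setT (H j : borel (pdual R G) -> \bar R).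
  exact: (measurable_fun_fubini_tonelli_G (m1 := muP j) _ (mn j) (fun z => sqr_normc_ge0 _)).
have GH j : (\int[muP j]_p G0 j p = \int[nu]_(w in Q) H j w)%E.
  exact: (fubini_restr (muP j) mQ Qoo (mn j) (fun z => sqr_normc_ge0 _)).
pose Hn n w := oapp (fun j => H j w) 0%E (pickle_inv n : option J).
have mHn n : measurable_fun setT (Hn n : borel (pdual R G) -> \bar R).
  by rewrite /Hn; case: pickle_inv => [j|]/=; [exact: mH|exact: measurable_cst].
have Hn0 n w : (0 <= Hn n w)%E.
  by rewrite /Hn; case: pickle_inv => [j|] //; exact: (H0 j w).
pose Hs : borel (pdual R G) -> \bar R :=
  fun w : pdual R G => (\esum_(j in [set: J]) H j w)%E.
have HsE : Hs = (fun w => \sum_(0 <= n <oo) Hn n w)%E.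
  by apply/funext => w; exact: esum_countType.
have Hs0 w : (0 <= Hs w)%E by exact: esum_ge0.
have mHs : measurable_fun setT (Hs : borel (pdual R G) -> \bar R).
  by rewrite HsE; exact: ge0_emeasurable_sum.
(* Monotone convergence exchanges the sum with the integral over [Q], and [GH] exchanges the two
   integrals in each term. *)
have finHs : (\int[nu]_(w in Q) Hs w < +oo)%E.
  rewrite HsE integral_nneseries//; last by move=> n; exact: measurable_funTS.
  move: fin; rewrite esum_countType//.
  congr (_ < _)%E; apply: eq_eseriesr => n _.
  rewrite /Hn; case: pickle_inv => [j|] /=; first exact: GH.
  by rewrite integral0.
change (nu.-integrable (K : set (borel (pdual R G))) Hs).
apply/integrableP; split; first exact: measurable_funTS.
rewrite (eq_integral Hs); last by move=> w _; rewrite gee0_abs//; exact: Hs0.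
apply: le_lt_trans finHs; apply: ge0_subset_integral => //.
exact: measurable_funTS.
Qed.
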